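(* Let $n\geq 2$. There exist rational numbers $c_{i,j}$ and $d_{i,j}$ such that for all $(u,v)\in\widehat{\mathbb C}_{\pm}$ $$\begin{aligned}\mathfrak R_n(\widehat{\mathcal L}_n(u,v))-\mathcal L_n(r(u,v))={}&\sum_{s=1}^{n-2}\Big(\mathfrak R_{n-s}(\widehat{\mathcal L}_{n-s}(u,v))\sum_{i=0}^s c_{i,s-i}\,\mathrm{Re}(u)^i\,\mathrm{Im}(u)^{s-i}\Big)\\&+\det(u\wedge v)\sum_{i=0}^{n-2}d_{i,n-2-i}\,\mathrm{Re}(u)^i\,\mathrm{Im}(u)^{n-2-i}.\end{aligned}$$
   Context: $\mathfrak R_n(x)$ denotes the real part of $x$ if $n$ is odd and the imaginary part if $n$ is even; for $(u,v)\in\mathbb C^2$, $\det(u\wedge v)=\mathrm{Re}(u)\mathrm{Im}(v)-\mathrm{Im}(u)\mathrm{Re}(v)$. $\mathrm{Log}$ is the main branch of the logarithm (argument in $(-\pi,\pi]$), $\mathrm{Li}_1(z)=-\mathrm{Log}(1-z)$, $\mathrm{Li}_k(z)=\int_0^1\frac{\mathrm{Li}_{k-1}(tz)}{t}dt$. $\mathcal L_n$ is the real single valued polylogarithm $$\mathcal L_n(z)=\mathfrak R_n\Big(\sum_{r=0}^{n-1}\frac{2^rB_r}{r!}\mathrm{Li}_{n-r}(z)(\log|z|)^r\Big),$$ with $B_r$ the Bernoulli numbers ($B_0=1$, $B_1=-1/2$, $B_2=1/6,\dots$). $\widehat{\mathbb C}_{\pm}$ is the disjoint union over signs of $\widehat{\mathbb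 C}_{\epsilon_1\epsilon_2}=\{(u,v)\in\mathbb C^2:\epsilon_1e^u+\epsilon_2e^v=1\}$, and $r:\widehat{\mathbb C}_\pm\to\mathbb C\setminus\{0,1\}$ takes $(u,v)\in\widehat{\mathbb C}_{\epsilon_1\epsilon_2}$ to $\epsilon_1e^u$. Write $(u,v)=\langle z;p,q\rangle_{\epsilon_1,\epsilon_2}=(\mathrm{Log}(\epsilon_1z)+2p\pi i,\mathrm{Log}(\epsilon_2(1-z))+2q\pi i)$ with $p,q\in\mathbb Z$, and $\mathcal Li_k(z;q)=\mathrm{Li}_k(z)-\frac{2q\pi i}{(k-1)!}\mathrm{Log}(z)^{k-1}$. On $\widehat{\mathbb C}_{++},\widehat{\mathbb C}_{+-},\widehat{\mathbb C}_{-+}$ one sets, for each $n\ge2$, $$\widehat{\mathcal L}_n(u,v)=\sum_{r=0}^{n-1}\frac{(-1)^r}{r!}\mathcal Li_{n-r}(z;q)u^r-\frac{(-1)^n}{n!}u^{n-1}v .$$ On $\widehat{\mathbb C}_{--}$, for $z\notin\mathbb R$, $\widehat{\mathcal L}_n$ is the same expression plus $\frac{(2\pi i)^n}{(n-1)!}\big(-(-p-\tfrac12)^{n-1}+(-\tfrac12)^{n-1}\big)$ if $\mathrm{Im}(z)>0$, and plus $\frac{(2\pi i)^n}{(n-1)!}(-\tfrac12)^{n-1}$ if $\mathrm{Im}(z)<0$, extended to real $z$ by continuity. $\widehat{\mathcal L}_n$ is holomorphic with values modulo $\frac{(2\pi i)^n}{(n-1)!}\mathbb Z$ on $\widehat{\mathbb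 C}_{++},\widehat{\mathbb C}_{+-}$ and modulo $\kappa_n\frac{(2\pi i)^n}{(n-1)!}\mathbb Z$ on $\widehat{\mathbb C}_{-+},\widehat{\mathbb C}_{--}$ ($\kappa_n=2^{2-n}$ for $n$ even, $2^{3+\nu_2(n-1)-n}$ for $n$ odd, $\nu_2$ the 2-adic valuation), so $\mathfrak R_n\circ\widehat{\mathcal L}_n$ is a well-defined real function. The $c_{i,j},d_{i,j}$ may depend on $n$ but not on $(u,v)$. *)

(* Defs.v *)
From HB Require Import structures.
From mathcomp Require Import all_boot all_order all_algebra.
From mathcomp Require Import all_classical all_reals all_analysis.
From mathcomp Require Import complex.

Set Implicit Arguments.
Unset Strict Implicit.
Unset Printing Implicit Defensive.

Import Order.TTheory GRing.Theory Num.Theory.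
Import ComplexField.Normc.

(* Num.Theory shadows the projections of R[i]. *)
Local Notation Re := complex.Re.
Local Notation Im := complex.Im.

Local Open Scope classical_set_scope.
Local Open Scope complex_scope.
Local Open Scope ring_scope.

(* [:: B_0; ...; B_n], from \sum_(k < m.+1) 'C(m.+1, k) B_k = [m = 0];
   this is the convention B_1 = - 1/2. *)
Fixpoint bernoulli_seq (n : nat) : seq rat :=
  let next s := let m := size s in
    rcons s (((m == 0%N)%:R - \sum_(k < m) 'C(m.+1, k)%:R * s`_k) / m.+1%:R) in
  if n is n'.+1 then next (bernoulli_seq n') else next [::].

Definition bernoulli_number (n : nat) : rat := (bernoulli_seq n)`_n.

Section ComplexFunctions.
Variable R : realType.
Implicit Types (z u v w : R[i]) (n k : nat).

Definition two_pi_i : R[i] := 0 +i* (2 * pi).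

Definition expC u : R[i] :=
  (expR (Re u) * cos (Im u)) +i* (expR (Re u) * sin (Im u)).

(* For z != 0 this is the argument in ]-pi, pi]. *)
Definition argC z : R :=
  if 0 <= Im z then acos (Re z / normc z) else - acos (Re z / normc z).

Definition LogC z : R[i] := ln (normc z) +i* argC z.

(* Lebesgue integral over [0, 1]: for z real > 1 the integrand defining Li_2
   has an integrable singularity at t = 1/z, so a Riemann integral would not
   do. *)
Definition integralC01 (f : R -> R[i]) : R[i] :=
  (\int[lebesgue_measure]_(t in `[0, 1]) Re (f t))
  +i* (\int[lebesgue_measure]_(t in `[0, 1]) Im (f t)).

(* Only the values for 1 <= k are meaningful. *)
Fixpoint Li k z : R[i] :=
  match k with
  | 0 => 0
  | 1 => - LogC (1 - z)
  | k'.+1 => integralC01 (fun t => Li k' (t%:C * z) / t%:C)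
  end.

Definition ReIm n z : R := if odd n then Re z else Im z.

Definition polylogR n z : R :=
  ReIm n (\sum_(r < n)
    ratr (2 ^+ r * bernoulli_number r / r`!%:R)
    * Li (n - r) z * (ln (normc z))%:C ^+ r).

Definition det_wedge u v : R := Re u * Im v - Im u * Re v.

End ComplexFunctions.

(* The four components are told apart by the two booleans: the signs are
   eps_i = (-1) ^+ neg_i. *)
Record hatC (R : realType) := HatC {
  neg1 : bool;
  neg2 : bool;
  uC : R[i];
  vC : R[i];
  hatC_eq : (-1) ^+ neg1 * expC uC + (-1) ^+ neg2 * expC vC = 1
}.

Section HatPolylog.
Variable R : realType.
Implicit Types (x y : hatC R) (z w : R[i]) (n k : nat).

Definition rC x : R[i] := (-1) ^+ neg1 x * expC (uC x).

(* The integers p, q (unique, and existing by hatC_eq) such that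
   (u, v) = <z; p, q>. *)
Definition pC x : int :=
  xget 0 [set p : int |
    uC x = LogC ((-1) ^+ neg1 x * rC x) + p%:~R * two_pi_i R].

Definition qC x : int :=
  xget 0 [set q : int |
    vC x = LogC ((-1) ^+ neg2 x * (1 - rC x)) + q%:~R * two_pi_i R].

Definition calLi k z (q : int) : R[i] :=
  Li k z - q%:~R * two_pi_i R / (k.-1)`!%:R * LogC z ^+ k.-1.

Definition hatL_formula n x : R[i] :=
  \sum_(r < n) (-1) ^+ r / r`!%:R * calLi (n - r) (rC x) (qC x) * uC x ^+ r
  - (-1) ^+ n / n`!%:R * uC x ^+ n.-1 * vC x.

Definition period n : R[i] := two_pi_i R ^+ n / (n.-1)`!%:R.

Definition kappa n : R[i] :=
  if odd n then 2 ^ (3 + (logn 2 n.-1)%:Z - n%:Z) else 2 ^ (2 - n%:Z).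

Definition hatL_mm n x : R[i] :=
  hatL_formula n x +
  (if 0 < Im (rC x) then
     period n * (- (- (pC x)%:~R - 2^-1) ^+ n.-1 + (- 2^-1) ^+ n.-1)
   else period n * (- 2^-1) ^+ n.-1).

(* w represents the limit at x, in C / (kappa_n period_n Z), of hatL_mm n y
   as y tends to x in the component (-,-) with r(y) not real. *)
Definition hatL_mm_limit n x w : Prop :=
  forall e : R, 0 < e -> exists2 d : R, 0 < d &
    forall y, neg1 y -> neg2 y -> Im (rC y) != 0 ->
      normc (uC y - uC x) < d -> normc (vC y - vC x) < d ->
      exists k : int,
        normc (hatL_mm n y + k%:~R * (kappa n * period n) - w) < e.

(* A representative in C of the value, which is only defined modulo
   period_n Z or kappa_n period_n Z.  Its choice does not affect
   ReIm n (hatL n x), since ReIm n kills the rational multiples of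
   two_pi_i ^+ n. *)
Definition hatL n x : R[i] :=
  if neg1 x && neg2 x then
    if Im (rC x) == 0 then xget 0 [set w | hatL_mm_limit n x w]
    else hatL_mm n x
  else hatL_formula n x.

End HatPolylog.

(* Main.v *)
Require Import Defs.
From HB Require Import structures.
From mathcomp Require Import all_boot all_order all_algebra.
From mathcomp Require Import all_classical all_reals all_analysis.
From mathcomp Require Import measurable_realfun complex.
From mathcomp Require Import ring lra zify.
Import Order.TTheory GRing.Theory Num.Theory.
Import ComplexField.Normc numFieldNormedType.Exports.

(** Fix (u, v), put z = r(u, v), a = Re u = log |z|, b = Im u, and write Li(t) for
    the generating series of the polylogarithms Li_n(z). The proof has an
    algebraic and an analytic half.

    Algebra. If the integers p, q and all corrections are ignored, hat L_n is the
    coefficient of t^n in exp (-ut) Li(t) - v (exp (-ut) - 1) / u, and the argument of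
    [ReIm] n in [polylogR] is that of (2at / (exp (2at) - 1)) Li(t). As
    2x / (exp (2x) - 1) = (x / sinh x) exp (-x) and u = a + ib, eliminating Li(t)
    expresses the second series as (at / sinh (at)) exp (ibt) times the first one, plus
    v (at / sinh (at)) (exp (-at) - exp (ibt)) / u ([polylog_ladder]). Now apply [ReIm] n.
    Since x / sinh x is even, its coefficients contribute even powers of the real
    number a, whereas each factor ib changes the parity of the index: the first
    summand becomes the combination of the [ReIm] (n-s) of the functions of index
    n-s, where s = 0 gives the function of index n itself and s = n-1 gives nothing
    because the real part of the function of index 1 vanishes. In the second
    summand the same evenness produces the factor v (ib - a), whose relevant part
    is the determinant ([ReIm_exp_diff_quot]).

    Analysis. It remains to see that [ReIm] n does not notice what was ignored
    ([ReIm_hatL]). The terms with p and q are rational multiples of (2 pi i)^n. The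
    delicate case is that of a real z on the component (-,-), where hat L_n is any
    limit, modulo kappa_n (2 pi i)^n / (n-1)!, of its values at nonreal points: one has
    to prove that a limit exists and to compute its relevant part. Existence
    follows from the continuity of the polylogarithms on the closed lower
    half-plane, where the singularity at 1 is controlled by a Hoelder estimate of
    exponent 1/2 that reproduces itself under the recursion defining Li_k
    ([log_hoelder_Li]), from the jump across the cut ([Li_conj_gt1]), and from
    the fact that powers of half-odd numbers agree modulo kappa_n
    ([half_odd_exp_sub]), which makes the limits from both sides agree. *)

Set Implicit Arguments.
Unset Strict Implicit.
Unset Printing Implicit Defensive.
Local Open Scope classical_set_scope.
Local Open Scope complex_scope.
Local Open Scope ring_scope.
Local Notation Re := complex.Re.
Local Notation Im := complex.Im.
Local Notation "x ^*" := (conjc x) : ring_scope.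

(** * Power series and Bernoulli numbers *)

Section CauchyProduct.
Variable F : comNzRingType.
Implicit Types f g h : nat -> F.

(** The coefficients of a product of power series, given by their coefficient
    sequences. *)
Definition cauchy_prod f g (n : nat) : F := \sum_(i < n.+1) f i * g (n - i)%N.

Lemma eq_cauchy f f' g g' : f =1 f' -> g =1 g' -> cauchy_prod f g =1 cauchy_prod f' g'.
Proof. by move=> ff' gg' n; apply: eq_bigr => i _; rewrite ff' gg'. Qed.

(** Up to a given degree, power series multiply like polynomials; the ring laws
    of [cauchy_prod] are read off from {poly F} in this way. *)
Lemma coef_cauchy f g (n N : nat) : (n < N)%N ->
  ((\poly_(i < N) f i) * (\poly_(i < N) g i))`_n = cauchy_prod f g n.
Proof.
move=> nN; rewrite coefM; apply: eq_bigr => i _.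
rewrite !coef_poly (leq_ltn_trans _ nN) ?(leq_ltn_trans (leq_subr _ _) nN)//.
by rewrite -ltnS.
Qed.

Lemma cauchyC f g : cauchy_prod f g =1 cauchy_prod g f.
Proof.
by move=> n; rewrite -(coef_cauchy f g (ltnSn n)) mulrC coef_cauchy.
Qed.

Lemma cauchyA f g h : cauchy_prod f (cauchy_prod g h) =1 cauchy_prod (cauchy_prod f g) h.
Proof.
move=> n; set P := fun k => \poly_(i < n.+1) k i : {poly F}.
(* products may be truncated again, as only low coefficients are compared *)
have E k l (i : nat) : (i < n.+1)%N -> (P k * P l)`_i = (P (cauchy_prod k l))`_i.
  by move=> lin; rewrite coef_cauchy// coef_poly lin.
rewrite -!(@coef_cauchy _ _ n n.+1)//.
transitivity ((P f * (P g * P h))`_n).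
  by rewrite !coefM; apply: eq_bigr => i _; rewrite E// ltnS leq_subr.
by rewrite mulrA !coefM; apply: eq_bigr => i _; rewrite E.
Qed.

Lemma cauchyDr f g h n :
  cauchy_prod f (fun k => g k + h k) n = cauchy_prod f g n + cauchy_prod f h n.
Proof. by rewrite -big_split/=; apply: eq_bigr => i _; rewrite mulrDr. Qed.

Lemma cauchyBr f g h n :
  cauchy_prod f (fun k => g k - h k) n = cauchy_prod f g n - cauchy_prod f h n.
Proof. by rewrite -sumrB/=; apply: eq_bigr => i _; rewrite mulrBr. Qed.

Lemma cauchyZr (c : F) f g n : cauchy_prod f (fun k => c * g k) n = c * cauchy_prod f g n.
Proof. by rewrite mulr_sumr; apply: eq_bigr => i _; rewrite mulrCA. Qed.

Lemma cauchy_expr (c : F) f g n :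
  cauchy_prod (fun k => c ^+ k * f k) (fun k => c ^+ k * g k) n = c ^+ n * cauchy_prod f g n.
Proof.
rewrite mulr_sumr; apply: eq_bigr => i _; rewrite mulrACA -exprD subnKC//.
by rewrite -ltnS.
Qed.

Lemma cauchy1r f n : cauchy_prod f (fun k => (k == 0%N)%:R) n = f n.
Proof.
rewrite /cauchy_prod big_ord_recr/= subnn eqxx mulr1 big1 ?add0r// => i _.
by rewrite subn_eq0 leqNgt ltn_ord mulr0.
Qed.

(** Such an f is t times a series whose constant term is regular, so that
    multiplication by f is injective: g 0, g 1, ... vanish in turn. *)
Lemma cauchy_inj0 f g : f 0%N = 0 -> GRing.lreg (f 1%N) ->
  (forall n, cauchy_prod g f n = 0) -> forall n, g n = 0.
Proof.
move=> f0 f1 gf0 n; elim/ltn_ind: n => n IH.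
apply: f1; rewrite mulr0 -(gf0 n.+1) /cauchy_prod 2!big_ord_recr/=.
rewrite subnn f0 mulr0 addr0 subSnn mulrC big1 ?add0r// => i _.
by rewrite IH// mul0r.
Qed.
End CauchyProduct.

Lemma rmorph_cauchy (F G : comNzRingType) (phi : {rmorphism F -> G})
    (f g : nat -> F) n :
  phi (cauchy_prod f g n) = cauchy_prod (phi \o f) (phi \o g) n.
Proof. by rewrite rmorph_sum; apply: eq_bigr => i _; rewrite rmorphM. Qed.

Section ExpSeq.
Variable F : numFieldType.

(** The series exp (c t). *)
Definition exp_coef (c : F) (k : nat) : F := c ^+ k / k`!%:R.

Lemma fact_neq0 k : k`!%:R != 0 :> F.
Proof. by rewrite pnatr_eq0 -lt0n fact_gt0. Qed.

Lemma bin_fact_inv n i : (i <= n)%N ->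
  'C(n, i)%:R / n`!%:R = (i`!%:R * (n - i)`!%:R)^-1 :> F.
Proof.
move=> lin; rewrite -natrM -(bin_fact lin) natrM invfM mulrA divff ?mul1r//.
by rewrite pnatr_eq0 -lt0n bin_gt0.
Qed.

Lemma cauchy_exp (c d : F) : cauchy_prod (exp_coef c) (exp_coef d) =1 exp_coef (c + d).
Proof.
move=> n; rewrite /exp_coef addrC exprDn mulr_suml; apply: eq_bigr => i _.
rewrite -[_ *+ 'C(_, _)]mulr_natr -!mulrA bin_fact_inv -1?ltnS// invfM; ring.
Qed.

Lemma exp_coef0 k : exp_coef 0 k = (k == 0%N)%:R.
Proof. by rewrite /exp_coef expr0n; case: k => [|k]; rewrite ?divr1 ?mul0r. Qed.

Lemma exp_coefM (c d : F) k : exp_coef (c * d) k = c ^+ k * exp_coef d k.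
Proof. by rewrite /exp_coef exprMn mulrA. Qed.

End ExpSeq.

Lemma size_bernoulli_seq n : size (bernoulli_seq n) = n.+1.
Proof. by elim: n => [//|n IH] /=; rewrite size_rcons IH. Qed.

Lemma nth_bernoulli_seq n k : (k <= n)%N ->
  (bernoulli_seq n)`_k = bernoulli_number k.
Proof.
elim: n => [|n IH]; first by rewrite leqn0 => /eqP ->.
rewrite leq_eqVlt => /orP[/eqP -> //|]; rewrite ltnS => kn.
by rewrite [bernoulli_seq _]/= nth_rcons size_bernoulli_seq ltnS kn IH.
Qed.

Lemma bernoulli_number0 : bernoulli_number 0 = 1.
Proof. by rewrite /bernoulli_number /= big_ord0 subr0 divr1. Qed.

Lemma bernoulli_numberE n : bernoulli_number n.+1 =
  - (\sum_(k < n.+1) 'C(n.+2, k)%:R * bernoulli_number k) / n.+2%:R.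
Proof.
rewrite /bernoulli_number [bernoulli_seq _]/= nth_rcons size_bernoulli_seq.
rewrite ltnn eqxx sub0r; congr (- _ / _); apply: eq_bigr => i _.
by rewrite (@nth_bernoulli_seq n i)// -ltnS.
Qed.

Lemma bernoulli_sum m :
  \sum_(k < m.+1) 'C(m.+1, k)%:R * bernoulli_number k = (m == 0%N)%:R.
Proof.
case: m => [|m]; first by rewrite big_ord1 bin0 mul1r bernoulli_number0.
rewrite big_ord_recr/= bernoulli_numberE binSn mulrCA divff ?pnatr_eq0//.
by rewrite mulr1 subrr.
Qed.

(** The series 2t / (exp (2t) - 1), whose coefficients are the weights of
    [polylogR]. *)
Definition todd_coef (r : nat) : rat := 2 ^+ r * bernoulli_number r / r`!%:R.

(** The recursion of the Bernoulli numbers, rescaled by the powers of 2. *)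
Lemma todd_expB1 n :
  cauchy_prod todd_coef (fun k => exp_coef 2 k - exp_coef 0 k) n = (n == 1)%:R * 2.
Proof.
have E0 : exp_coef 2 0 - exp_coef 0 0 = 0 :> rat by rewrite /exp_coef subrr.
rewrite /cauchy_prod big_ord_recr/= subnn E0 mulr0 addr0.
case: n => [|m]; first by rewrite big_ord0 mul0r.
transitivity (2 ^+ m.+1 / m.+1`!%:R * (m == 0%N)%:R : rat); last first.
  by case: m => [|m]; rewrite ?mulr0 ?mul0r// expr1 divr1 mulr1 mul1r.
rewrite -bernoulli_sum mulr_sumr; apply: eq_bigr => i _.
have lim : (i <= m.+1)%N by rewrite ltnW// -ltnS.
rewrite exp_coef0 subn_eq0 leqNgt ltn_ord subr0 /todd_coef.
have -> : 2 ^+ m.+1 / m.+1`!%:R * ('C(m.+1, i)%:R * bernoulli_number i) =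
  2 ^+ m.+1 * ('C(m.+1, i)%:R / m.+1`!%:R) * bernoulli_number i :> rat by ring.
rewrite bin_fact_inv//.
rewrite /exp_coef -[in 2 ^+ m.+1](subnKC lim) exprD invfM; ring.
Qed.

(** The series t / sinh t = exp t * (2t / (exp (2t) - 1)). *)
Definition xcsch_coef : nat -> rat := cauchy_prod todd_coef (exp_coef 1).

Lemma xcsch_sinh n :
  cauchy_prod xcsch_coef (fun k => exp_coef 1 k - exp_coef (-1) k) n = (n == 1)%:R * 2.
Proof.
rewrite -todd_expB1 /xcsch_coef -cauchyA; apply: eq_cauchy => // k.
rewrite cauchyBr !cauchy_exp; congr (exp_coef _ k - exp_coef _ k); ring.
Qed.

(** t / sinh t is even: both S(t) and S(-t) give 2t when multiplied by
    exp t - exp (-t), and this factor can be cancelled. *)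
Lemma xcsch_coef_odd k : odd k -> xcsch_coef k = 0.
Proof.
pose T j := (-1) ^+ j * xcsch_coef j.
pose E (k : nat) : rat := exp_coef 1 k - exp_coef (-1) k.
suff TS n : xcsch_coef n - T n = 0.
  by move=> ok; move: (TS k); rewrite /T -signr_odd ok expr1; lra.
apply: (@cauchy_inj0 _ E (fun j => xcsch_coef j - T j)) => [||j].
- by rewrite /E /exp_coef !expr0 subrr.
- by apply/lregP; rewrite /E /exp_coef !expr1 divr1.
have EN i : E i = - ((-1) ^+ i * E i).
  rewrite /E /exp_coef expr1n; case: (odd i) (signr_odd rat i) => <- /=; ring.
rewrite cauchyC cauchyBr [X in X - _]cauchyC xcsch_sinh.
rewrite (@eq_cauchy _ E (fun i => -1 * ((-1) ^+ i * E i)) T T)//; last first.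
  by move=> i; rewrite mulN1r -EN.
rewrite cauchyC cauchyZr cauchy_expr xcsch_sinh.
by case: eqP => [->|]; rewrite ?mul0r ?mulr0 ?subr0//; ring.
Qed.

Lemma xcsch_coef0 : xcsch_coef 0 = 1.
Proof.
by rewrite /xcsch_coef /cauchy_prod big_ord1 /todd_coef /exp_coef bernoulli_number0.
Qed.

Lemma xcsch_expN1 k : cauchy_prod xcsch_coef (exp_coef (-1)) k = todd_coef k.
Proof.
rewrite -cauchyA -[RHS](cauchy1r todd_coef).
by apply: eq_cauchy => // j; rewrite cauchy_exp subrr exp_coef0.
Qed.

(** The coefficient of t^n in (t / sinh t) * sinh t = t; for odd n only the odd
    coefficients of sinh are met, because t / sinh t is even. *)
Lemma xcsch_sinh_odd n : odd n -> (1 < n)%N ->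
  \sum_(k < n) xcsch_coef k / (n - k)`!%:R = 0.
Proof.
move=> on n1; have := xcsch_sinh n.
rewrite (gtn_eqF n1) mul0r /cauchy_prod big_ord_recr/= subnn.
rewrite /exp_coef !expr0 subrr mulr0 addr0 => H.
apply: (@mulIf _ 2) => //; rewrite mul0r -[RHS]H mulr_suml.
apply: eq_bigr => i _; case: (boolP (odd i)) => oi.
  by rewrite xcsch_coef_odd// !mul0r.
rewrite expr1n -[(-1) ^+ _]signr_odd oddB ?(ltnW (ltn_ord i))// on (negPf oi) expr1.
ring.
Qed.

(** * Real and imaginary parts *)

Section ReImAlgebra.
Variable R : realType.
Implicit Types (x y : R[i]) (m n : nat).

(* The lemmas of the same names in Num.Theory are about ['Re] and ['Im]. *)
Lemma ReD x y : Re (x + y) = Re x + Re y. Proof. by case: x; case: y. Qed.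
Lemma ImD x y : Im (x + y) = Im x + Im y. Proof. by case: x; case: y. Qed.
Lemma ReN x : Re (- x) = - Re x. Proof. by case: x. Qed.
Lemma ImN x : Im (- x) = - Im x. Proof. by case: x. Qed.
Lemma ReB x y : Re (x - y) = Re x - Re y. Proof. by rewrite ReD ReN. Qed.
Lemma ImB x y : Im (x - y) = Im x - Im y. Proof. by rewrite ImD ImN. Qed.
Lemma ReM x y : Re (x * y) = Re x * Re y - Im x * Im y.
Proof. by case: x; case: y. Qed.
Lemma ImM x y : Im (x * y) = Re x * Im y + Im x * Re y.
Proof. by case: x; case: y => * /=; rewrite addrC (addrC _ (_ * _)). Qed.

Lemma ReImD n x y : ReIm n (x + y) = ReIm n x + ReIm n y.
Proof. by rewrite /ReIm; case: ifP => _; rewrite (ReD, ImD). Qed.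
Lemma ReImN n x : ReIm n (- x) = - ReIm n x.
Proof. by rewrite /ReIm; case: ifP => _; rewrite (ReN, ImN). Qed.
Lemma ReImB n x y : ReIm n (x - y) = ReIm n x - ReIm n y.
Proof. by rewrite ReImD ReImN. Qed.
Lemma ReIm0 n : ReIm n (0 : R[i]) = 0.
Proof. by rewrite /ReIm; case: ifP. Qed.
Lemma ReImZ n (r : R) x : ReIm n (r%:C * x) = r * ReIm n x.
Proof.
rewrite /ReIm; case: ifP => _; first by rewrite ReM/= mul0r subr0.
by rewrite ImM/= mul0r addr0.
Qed.
Lemma ReIm_sum (I : Type) (s : seq I) (P : pred I) n (F : I -> R[i]) :
  ReIm n (\sum_(i <- s | P i) F i) = \sum_(i <- s | P i) ReIm n (F i).
Proof. exact: (big_morph _ (ReImD n) (ReIm0 n)). Qed.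

Lemma eq_ReIm m n : odd m = odd n -> @ReIm R m = ReIm n.
Proof. by rewrite /ReIm => ->. Qed.

(** Multiplication by i exchanges real and imaginary parts up to sign, and so
    does the passage from n to n+1 in [ReIm]; this is the resulting sign after l
    steps. *)
Definition sgnI m l : rat := \prod_(j < l) (-1) ^+ (m + j).+1.

Lemma ReIm_imX m l x : ReIm (m + l) ('i%C ^+ l * x) = ratr (sgnI m l) * ReIm m x.
Proof.
elim: l => [|l IH]; first by rewrite addn0 mul1r /sgnI big_ord0 rmorph1 mul1r.
rewrite /sgnI big_ord_recr/= -/(sgnI m l) rmorphM/= mulrAC -IH exprS -mulrA.
rewrite rmorphXn rmorphN1 -signr_odd /= addnS; set y := _ * x.
rewrite /ReIm /=; case: (odd _) => /=; rewrite ?expr1 ?expr0.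
  by rewrite ImM/= mul0r add0r mul1r mulr1.
by rewrite ReM/= mul0r sub0r mul1r mulrN1.
Qed.

Lemma ratrC q : ratr q = (ratr q)%:C :> R[i].
Proof. by rewrite -(fmorph_eq_rat (real_complex R \o ratr)). Qed.

(** i^n times a real number is real for even n and imaginary for odd n, which is
    the part that [ReIm] n discards. *)
Lemma ReIm_imX_real n (r : R) : ReIm n ('i%C ^+ n * r%:C) = 0.
Proof. by rewrite -[n in ReIm n]add0n ReIm_imX mulr0. Qed.

End ReImAlgebra.

Lemma ratrN (F : numFieldType) q : ratr (- q) = - ratr q :> F.
Proof. exact: rmorphN. Qed.

Lemma ratr0 (F : unitRingType) : ratr 0 = 0 :> F.
Proof. by rewrite /ratr mul0r. Qed.

(** * The algebraic identity *)

Section AlgebraicIdentity.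
Variables (R : realType) (lam : nat -> R[i]) (u v : R[i]).
Hypothesis lam0 : lam 0%N = 0.
Local Notation a := (Re u).
Local Notation b := (Im u).

(** The common shape of the functions hat L_n, with an arbitrary sequence lam in
    place of the polylogarithms. Its generating series is
    exp (-ut) * lam(t) - v * (exp (-ut) - 1) / u. *)
Definition ladder n : R[i] :=
  \sum_(r < n) (-1) ^+ r / r`!%:R * lam (n - r) * u ^+ r
  - (-1) ^+ n / n`!%:R * u ^+ n.-1 * v.

(** The series (exp (-ut) - 1) / u, divided coefficientwise so that it also
    makes sense for u = 0. *)
Definition expB1_div k : R[i] := (0 < k)%:R * ((-1) ^+ k / k`!%:R * u ^+ k.-1).

Lemma cauchy_expN_lam n :
  \sum_(r < n) (-1) ^+ r / r`!%:R * lam (n - r) * u ^+ r =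
  cauchy_prod (exp_coef (- u)) lam n.
Proof.
rewrite /cauchy_prod big_ord_recr/= subnn lam0 mulr0 addr0; apply: eq_bigr => i _.
by rewrite /exp_coef [(- u) ^+ _]exprNn; ring.
Qed.

Lemma ladderE n : (0 < n)%N ->
  ladder n = cauchy_prod (exp_coef (- u)) lam n - v * expB1_div n.
Proof. by rewrite /ladder cauchy_expN_lam /expB1_div => ->; rewrite mul1r mulrC. Qed.

(** The series at / sinh (at), where a = Re u. *)
Definition xcschC k : R[i] := a%:C ^+ k * ratr (xcsch_coef k).
Definition ib : R[i] := 'i%C * b%:C.

Lemma uE : u = a%:C + ib.
Proof. by rewrite /ib [LHS]complexE. Qed.

Lemma ratr_exp_coef q k : ratr (exp_coef q k) = exp_coef (ratr q) k :> R[i].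
Proof. by rewrite /exp_coef fmorph_div/= rmorphXn/= ratr_nat. Qed.

(** 2x / (exp (2x) - 1) = (x / sinh x) * exp (-x) at x = at. *)
Lemma todd_xcsch k :
  ratr (todd_coef k) * a%:C ^+ k = cauchy_prod xcschC (exp_coef (- a%:C)) k.
Proof.
rewrite mulrC -xcsch_expN1 rmorph_cauchy -cauchy_expr; apply: eq_cauchy => // j.
by rewrite -[- a%:C]mulrN1 exp_coefM /= ratr_exp_coef rmorphN1.
Qed.

(** The series (exp (-at) - exp (ibt)) / u with a = Re u and b = Im u: since
    u = a + ib, the numerator is divisible by u coefficientwise. *)
Definition exp_diff_quot m : R[i] :=
  - ((\sum_(j < m) (- a%:C) ^+ (m.-1 - j) * ib ^+ j) / m`!%:R).

Lemma cauchy_ib_expB1_div m : cauchy_prod (exp_coef ib) expB1_div m = exp_diff_quot m.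
Proof.
have [u0|u0] := eqVneq u 0.
  have a0 : a%:C = 0 by rewrite u0.
  have b0 : ib = 0 by rewrite /ib u0 mulr0.
  transitivity (expB1_div m).
    by rewrite cauchyC -[RHS](cauchy1r expB1_div); apply: eq_cauchy => // k;
      rewrite b0 exp_coef0.
  rewrite /expB1_div /exp_diff_quot a0 b0 oppr0 u0.
  case: m => [|[|m]]; first by rewrite big_ord0 !mul0r oppr0.
    by rewrite big_ord1/= !expr0 !divr1 !mulr1 mul1r expr1.
  rewrite expr0n/= !mulr0 big1 ?mul0r ?oppr0// => i _.
  rewrite !expr0n; case: eqP => /= [|_]; last by rewrite mul0r.
  by case: i => -[|i] /= _; rewrite ?mulr0// => /eqP; rewrite subn0.
apply: (mulfI u0); rewrite -cauchyZr.
transitivity (cauchy_prod (exp_coef ib) (fun k => exp_coef (- u) k - exp_coef 0 k) m).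
  apply: eq_cauchy => // k; rewrite exp_coef0 /expB1_div /exp_coef [(- u) ^+ _]exprNn.
  case: k => [|k]; first by rewrite mul0r mulr0 !expr0 mul1r divr1 subrr.
  by rewrite /= mul1r subr0 [u ^+ k.+1]exprS; ring.
rewrite cauchyBr !cauchy_exp addr0 {1 2}uE /exp_diff_quot /exp_coef.
have -> : ib - (a%:C + ib) = - a%:C by ring.
rewrite -mulrBl subrXX; field; exact: fact_neq0.
Qed.

(** The power series whose coefficients of positive index are those of [ladder];
    its constant term is 0. *)
Definition ladder0 m : R[i] :=
  cauchy_prod (exp_coef (- u)) lam m - v * expB1_div m.

Lemma ladder00 : ladder0 0 = 0.
Proof.
by rewrite /ladder0 /cauchy_prod big_ord1 subnn lam0 /expB1_div ltnn mul0r !mulr0 subr0.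
Qed.

(** From exp (-ut) * lam = ladder0 + v * (exp (-ut) - 1) / u and u = a + ib one
    gets exp (-at) * lam = exp (ibt) * ladder0 + v * (exp (-at) - exp (ibt)) / u;
    multiplication by at / sinh (at) turns the left-hand side into the series
    of [polylogR]. *)
Lemma polylog_ladder n :
  \sum_(r < n) ratr (todd_coef r) * lam (n - r) * a%:C ^+ r =
  cauchy_prod (cauchy_prod xcschC (exp_coef ib)) ladder0 n
  + v * cauchy_prod xcschC exp_diff_quot n.
Proof.
transitivity (cauchy_prod (cauchy_prod xcschC (exp_coef (- a%:C))) lam n).
  rewrite /cauchy_prod big_ord_recr/= subnn lam0 mulr0 addr0.
  by apply: eq_bigr => i _; rewrite mulrAC todd_xcsch.
rewrite -[LHS]cauchyA.
rewrite -[cauchy_prod _ ladder0 _]cauchyA.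
rewrite -[v * _]cauchyZr.
rewrite -[RHS]cauchyDr.
apply: eq_cauchy => // m.
rewrite -cauchy_ib_expB1_div -[v * _]cauchyZr -[RHS]cauchyDr.
rewrite [RHS](@eq_cauchy _ _ (exp_coef ib) _ (cauchy_prod (exp_coef (- u)) lam))//.
  2: by move=> k; rewrite /ladder0 subrK.
rewrite [RHS]cauchyA.
by apply: eq_cauchy => // k; rewrite cauchy_exp {2}uE; congr exp_coef; ring.
Qed.

(** Up to sign, the coefficient of a^i (ib)^(n-1-i) in the n-th
    coefficient of (at / sinh (at)) * (exp (-at) - exp (ibt)) / u. *)
Definition xcsch_partial n i : rat :=
  \sum_(k < i.+1) xcsch_coef k / (n - k)`!%:R.

Definition even_part (g : nat -> rat) i : rat := if odd i then 0 else g i.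

Lemma cauchy_exp_diff_quot n :
  cauchy_prod xcschC exp_diff_quot n =
  - \sum_(i < n) ratr (xcsch_partial n i) * (- a%:C) ^+ i * ib ^+ (n.-1 - i).
Proof.
rewrite /cauchy_prod big_ord_recr/= subnn {2}/exp_diff_quot big_ord0 mul0r oppr0.
rewrite mulr0 addr0.
pose F (k j : nat) : R[i] := xcschC k *
  ((- a%:C) ^+ ((n - k).-1 - j) * ib ^+ j / (n - k)`!%:R).
transitivity (- \sum_(k < n) \sum_(j < n) if (j < n - k)%N then F k j else 0).
  rewrite -sumrN; apply: eq_bigr => k _.
  rewrite -big_mkcond -(big_ord_widen n (F k)) ?leq_subr//.
  by rewrite /exp_diff_quot mulrN mulr_suml mulr_sumr.
(* the power of ib is n-1-i after reversal, so that k ranges up to i *)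
rewrite exchange_big (reindex_inj rev_ord_inj)/=; congr (- _).
apply: eq_bigr => i _; have ltin := ltn_ord i.
rewrite -big_mkcond/= (eq_bigl (fun k : 'I_n => k < i.+1)%N); last by move=> k; lia.
rewrite -(big_ord_widen n (fun k => F k (n - i.+1)%N))// rmorph_sum !mulr_suml.
apply: eq_bigr => k _; have ltki := ltn_ord k; rewrite /F /xcschC.
case: (boolP (odd k)) => ok; first by rewrite xcsch_coef_odd// mul0r !ratr0; ring.
have -> : ((n - k).-1 - (n - i.+1) = i - k)%N by lia.
have -> : (n.-1 - i = n - i.+1)%N by lia.
have E : a%:C ^+ k = (- a%:C) ^+ k by rewrite exprNn -signr_odd (negPf ok) mul1r.
have -> : (- a%:C) ^+ i = a%:C ^+ k * (- a%:C) ^+ (i - k).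
  by rewrite E -exprD subnKC.
by rewrite fmorph_div/= ratr_nat; ring.
Qed.

Lemma xcsch_partial_evenS n i : ~~ odd i ->
  xcsch_partial n i.+1 = xcsch_partial n i.
Proof.
by move=> oi; rewrite /xcsch_partial big_ord_recr/= xcsch_coef_odd ?mul0r ?addr0.
Qed.

Lemma xcsch_partial_last n : (1 < n)%N -> even_part (xcsch_partial n) n.-1 = 0.
Proof.
move=> n1; rewrite /even_part; case: ifPn => // on.
have n0 : (0 < n)%N by exact: ltnW.
rewrite /xcsch_partial (prednK n0); apply: xcsch_sinh_odd => //.
by move: on; rewrite -{2}(prednK n0) /=.
Qed.

(** The sum is divisible by w - a because its coefficients come in pairs: the
    one of index i+1, i even, equals the one of index i up to sign, since
    t / sinh t is even, and an unpaired last one vanishes since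
    (t / sinh t) * sinh t = t. This divisibility is what makes the determinant
    appear. *)
Lemma sum_xcsch_partial n w : (1 < n)%N ->
  \sum_(i < n) ratr (xcsch_partial n i) * (- a%:C) ^+ i * w ^+ (n.-1 - i) =
  (w - a%:C) *
  \sum_(i < n.-1) ratr (even_part (xcsch_partial n) i) * a%:C ^+ i * w ^+ (n - 2 - i).
Proof.
move=> n1; have := xcsch_partial_last n1; case: n n1 => // n n1 /= eN.
set g := xcsch_partial _ in eN *; set e := even_part g in eN *.
pose G i : R[i] := ratr (e i) * a%:C ^+ i * w ^+ (n - i).
have -> : (w - a%:C) *
    (\sum_(i < n) ratr (e i) * a%:C ^+ i * w ^+ (n.+1 - 2 - i)) =
  (\sum_(i < n.+1) G i) - \sum_(i < n) ratr (e i) * a%:C ^+ i.+1 * w ^+ (n - i.+1).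
  rewrite big_ord_recr/= /G eN ratr0 !mul0r addr0 -sumrB mulr_sumr.
  apply: eq_bigr => i _; have ltin := ltn_ord i.
  have -> : (n - i = (n - i.+1).+1)%N by lia.
  have -> : (n.+1 - 2 - i = n - i.+1)%N by lia.
  by rewrite !exprS; ring.
rewrite !big_ord_recl -addrA /G /= {1}/e /even_part /= !expr0; congr (_ + _).
rewrite -sumrB; apply: eq_bigr => i _; rewrite /bump add1n !exprSr /e /even_part /=.
rewrite -mulrBl exprNn -signr_odd.
case: (boolP (odd i)) => oi; rewrite /= ?ratr0 ?subr0 ?sub0r; first ring.
rewrite /g xcsch_partial_evenS//; ring.
Qed.

(** The opposite of the coefficient of a^i b^j in (at / sinh (at)) exp (ibt), with
    the power of the imaginary unit replaced by the sign with which it acts on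
    [ReIm]. *)
Definition coefC n i j : rat := - (xcsch_coef i / j`!%:R * sgnI (n - (i + j)) j).
(** The coefficient of a^i b^(n-2-i) that is left when ib - a is divided out, again
    with a sign in place of the power of the imaginary unit. *)
Definition coefD n i : rat :=
  - (even_part (xcsch_partial n) i * sgnI 1 (n - i.+1)).

(** A nonzero coefficient of at / sinh (at) comes with an even power of the real
    number a and leaves the parity of n alone; the powers of ib shift it. *)
Lemma ReIm_ladder_term n s x : (s <= n)%N ->
  ReIm n (cauchy_prod xcschC (exp_coef ib) s * x) =
  - (ReIm (n - s) x *
     \sum_(i < s.+1) ratr (coefC n i (s - i)) * a ^+ i * b ^+ (s - i)).
Proof.
move=> sn; rewrite mulr_suml ReIm_sum mulr_sumr -sumrN; apply: eq_bigr => i _.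
have is_ : (i <= s)%N by rewrite -ltnS.
case: (boolP (odd i)) => oi.
  have -> : coefC n i (s - i) = 0.
    by rewrite /coefC xcsch_coef_odd// mul0r mul0r oppr0.
  have -> : xcschC i = 0 by rewrite /xcschC xcsch_coef_odd// ratr0 mulr0.
  by rewrite ratr0 2!mul0r ReIm0 mul0r mul0r mulr0 oppr0.
rewrite /coefC subnKC//.
set q := _ / _.
rewrite (_ : xcschC i * _ * x =
  (a ^+ i * b ^+ (s - i))%:C * ((ratr q)%:C * ('i%C ^+ (s - i) * x))); last first.
  rewrite -ratrC /q fmorph_div/= ratr_nat /xcschC /exp_coef /ib exprMn.
  by rewrite rmorphM/= !rmorphXn/=; ring.
rewrite !ReImZ (@eq_ReIm _ n (n - s + (s - i))%N); last first.
  by rewrite addnBA// subnK// oddB ?(negPf oi) ?addbF// (leq_trans is_).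
by rewrite ReIm_imX rmorphN/= [ratr (_ * _)]rmorphM/=; ring.
Qed.

(** The factor ib - a of [sum_xcsch_partial] combines with v into
    - (a Re v + b Im v) - i det (u wedge v). In the remaining sum the exponents of
    ib have the parity of n, so that [ReIm] n kills the real number
    a Re v + b Im v and only the determinant survives. *)
Lemma ReIm_exp_diff_quot n : (1 < n)%N ->
  ReIm n (v * cauchy_prod xcschC exp_diff_quot n) =
  - (det_wedge u v *
     \sum_(i < n.-1) ratr (coefD n i) * a ^+ i * b ^+ (n - 2 - i)).
Proof.
move=> n1; rewrite cauchy_exp_diff_quot sum_xcsch_partial// mulrN mulrA ReImN.
congr (- _); rewrite mulr_sumr ReIm_sum mulr_sumr; apply: eq_bigr => i _.
have ltin := ltn_ord i; rewrite /coefD /even_part; case: ifPn => oi.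
  by rewrite mul0r oppr0 !ratr0 mul0r mul0r mulr0 ReIm0 mul0r mul0r mulr0.
set q := xcsch_partial n i.
rewrite (_ : _ * _ * _ = (ratr q * a ^+ i * b ^+ (n - 2 - i) * - (a * Re v + b * Im v))%:C
   * ('i%C ^+ (n - 2 - i) * 1%:C) +
   (ratr q * a ^+ i * b ^+ (n - 2 - i) * - det_wedge u v)%:C
   * ('i%C ^+ (n - i.+1) * 1)); last first.
  have -> : (n - i.+1 = (n - 2 - i).+1)%N by lia.
  rewrite exprS /ib {1}(complexE v) /det_wedge.
  rewrite exprMn ratrC; move: (ratr q) => rq.
  rewrite !rmorphM !rmorphXn !rmorphN !rmorphB !rmorphD !rmorphM/=.
  have := sqr_i R; move: ('i%C) => ii; rewrite expr2 => i2.
  ring: i2.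
rewrite ReImD !ReImZ (@eq_ReIm _ n (n - 2 - i)%N); last first.
  by rewrite -subnDA oddB/= ?(negPf oi) ?addbF//; lia.
rewrite ReIm_imX_real mulr0 add0r.
rewrite (@eq_ReIm _ (n - 2 - i) (1 + (n - i.+1))%N); last first.
  by rewrite -subnDA !oddB ?oddD//= ?(negPf oi); lia.
by rewrite ReIm_imX /ReIm/= ratrN mulr1 [ratr (_ * _)]rmorphM/= -/q; ring.
Qed.


(** The identity of the theorem for an abstract sequence lam; the term s = n-1,
    which would involve [ladder] 1, drops out by the hypothesis on its real part. *)
Lemma ReIm_ladder n : (1 < n)%N -> Re (ladder 1) = 0 ->
  ReIm n (ladder n) -
    ReIm n (\sum_(r < n) ratr (todd_coef r) * lam (n - r) * a%:C ^+ r) =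
  \sum_(1 <= s < n.-1) (ReIm (n - s) (ladder (n - s)) *
     \sum_(i < s.+1) ratr (coefC n i (s - i)) * a ^+ i * b ^+ (s - i))
  + det_wedge u v *
     \sum_(i < n.-1) ratr (coefD n i) * a ^+ i * b ^+ (n - 2 - i).
Proof.
move=> n1 L1; rewrite polylog_ladder [ReIm n (_ + v * _)]ReImD ReIm_exp_diff_quot//.
rewrite [cauchy_prod _ ladder0 n]/cauchy_prod ReIm_sum.
have L0 m : (0 < m)%N -> ladder0 m = ladder m by move=> m0; rewrite ladderE.
case: n n1 => [|[|n]]// _.
rewrite (eq_bigr (fun s : 'I_ _ => - (ReIm (n.+2 - s) (ladder0 (n.+2 - s)) *
     \sum_(i < s.+1) ratr (coefC n.+2 i (s - i)) * a ^+ i * b ^+ (s - i)))).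
  2: by move=> s _; rewrite ReIm_ladder_term// -ltnS.
rewrite -(big_mkord xpredT (fun s => - (ReIm (n.+2 - s) (ladder0 (n.+2 - s)) *
     \sum_(i < s.+1) ratr (coefC n.+2 i (s - i)) * a ^+ i * b ^+ (s - i)))).
rewrite [\sum_(0 <= _ < _) _]big_nat_recr//.
rewrite [\sum_(0 <= _ < _) _]big_nat_recr//=.
rewrite subnn ladder00 ReIm0 mul0r oppr0 addr0.
rewrite subSnn (L0 1%N)// [ReIm 1 _]/ReIm /= L1 mul0r oppr0 addr0 big_ltn//.
rewrite big_ord1 subn0 L0// /coefC xcsch_coef0 /sgnI big_ord0 !expr0.
rewrite sumrN (_ : ratr _ = -1 :> R); last first.
  by rewrite divr1 mulr1 rmorphN1.
rewrite (eq_big_nat _ _ (F2 := fun s => ReIm (n.+2 - s) (ladder (n.+2 - s)) *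
     \sum_(i < s.+1) ratr (coefC n.+2 i (s - i)) * a ^+ i * b ^+ (s - i))).
  by ring.
move=> s /andP[_ sn]; rewrite L0// subn_gt0; lia.
Qed.

End AlgebraicIdentity.

(** * Complex exponential and logarithm *)

Section ComplexNorm.
Variable R : realType.
Implicit Types (x y z : R[i]).

Lemma normc_ge0 x : 0 <= normc x. Proof. by case: x => *; apply: sqrtr_ge0. Qed.

Lemma normc_sqr x : normc x ^+ 2 = Re x ^+ 2 + Im x ^+ 2.
Proof. by case: x => a b; rewrite sqr_sqrtr// addr_ge0// sqr_ge0. Qed.

Lemma Re_le_normc x : `|Re x| <= normc x.
Proof.
rewrite -(ler_pXn2r (n := 2)) ?nnegrE ?normc_ge0//.
by rewrite real_normK ?num_real// normc_sqr lerDl sqr_ge0.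
Qed.

Lemma Im_le_normc x : `|Im x| <= normc x.
Proof.
rewrite -(ler_pXn2r (n := 2)) ?nnegrE ?normc_ge0//.
by rewrite real_normK ?num_real// normc_sqr lerDr sqr_ge0.
Qed.

Lemma normc_le_ReIm x : normc x <= `|Re x| + `|Im x|.
Proof.
rewrite -(ler_pXn2r (n := 2)) ?nnegrE ?normc_ge0 ?addr_ge0//.
rewrite normc_sqr sqrrD !real_normK ?num_real// addrAC lerDl.
by rewrite mulrn_wge0// mulr_ge0.
Qed.

Lemma normc_real (r : R) : normc r%:C = `|r|.
Proof. by rewrite /= expr0n addr0 sqrtr_sqr. Qed.

Lemma normc_eq0 x : (normc x == 0) = (x == 0).
Proof. by apply/eqP/eqP => [/eq0_normc//|->]; exact: normc0. Qed.

Lemma normc_gt0 x : (0 < normc x) = (x != 0).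
Proof. by rewrite lt_neqAle normc_ge0 andbT eq_sym normc_eq0. Qed.

Lemma normcBC x y : normc (x - y) = normc (y - x).
Proof. by rewrite -opprB normcN. Qed.

Lemma normcB_ge x y : normc x - normc y <= normc (x - y).
Proof. by rewrite lerBlDr -{1}(subrK y x) le_normcD. Qed.

Lemma normcB_dist x y : `|normc x - normc y| <= normc (x - y).
Proof.
rewrite ler_norml normcB_ge andbT lerNl opprB.
by rewrite (le_trans (normcB_ge _ _))// normcBC.
Qed.

Lemma Re_conjc x : Re x^* = Re x. Proof. by case: x. Qed.
Lemma Im_conjc x : Im x^* = - Im x. Proof. by case: x. Qed.
Lemma normc_conjc x : normc x^* = normc x.
Proof. by case: x => a b /=; rewrite sqrrN. Qed.

End ComplexNorm.

Section ExpLog.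
Variable R : realType.
Implicit Types (x y z u v : R[i]).
Local Notation tpi := (two_pi_i R).

Lemma expCD x y : expC (x + y) = expC x * expC y.
Proof.
rewrite /expC ReD ImD expRD cosD sinD; apply/eqP; rewrite eq_complex /=.
by apply/andP; split; apply/eqP; ring.
Qed.

Lemma normc_expC x : normc (expC x) = expR (Re x).
Proof.
by rewrite /= !exprMn -mulrDr cos2Dsin2 mulr1 sqrtr_sqr ger0_norm ?expR_ge0.
Qed.

Lemma expC_neq0 x : expC x != 0.
Proof. by rewrite -normc_gt0 normc_expC expR_gt0. Qed.

Lemma Re_div_normc_itv z : -1 <= Re z / normc z <= 1.
Proof.
rewrite -ler_norml; have [->|z0] := eqVneq z 0; first by rewrite mul0r normr0.
rewrite normf_div (ger0_norm (normc_ge0 z)) ler_pdivrMr ?normc_gt0// mul1r.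
exact: Re_le_normc.
Qed.

Lemma cos_argC z : cos (argC z) = Re z / normc z.
Proof.
by rewrite /argC; case: ifP => _; rewrite ?cosN acosK// in_itv/= Re_div_normc_itv.
Qed.

Lemma sin_argC z : z != 0 -> sin (argC z) = Im z / normc z.
Proof.
move=> z0; have n0 : 0 < normc z by rewrite normc_gt0.
have E : Num.sqrt (1 - (Re z / normc z) ^+ 2) = `|Im z| / normc z.
  rewrite -[RHS]ger0_norm ?divr_ge0 ?normc_ge0// -sqrtr_sqr; congr Num.sqrt.
  rewrite !expr_div_n real_normK ?num_real//.
  have -> : Im z ^+ 2 = normc z ^+ 2 - Re z ^+ 2 by rewrite normc_sqr; ring.
  by field; rewrite gt_eqF.
rewrite /argC; case: (leP 0 (Im z)) => Iz; rewrite ?sinN sin_acos ?Re_div_normc_itv// E.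
  by rewrite ger0_norm.
by rewrite ltr0_norm// mulNr opprK.
Qed.

Lemma expC_LogC z : z != 0 -> expC (LogC z) = z.
Proof.
move=> z0; have n0 : 0 < normc z by rewrite normc_gt0.
rewrite /expC /= lnK ?posrE// cos_argC sin_argC//.
by apply/eqP; rewrite eq_complex /=; apply/andP; split; apply/eqP;
   field; rewrite gt_eqF.
Qed.

Lemma sin_int_mulpi (p : int) : sin (p%:~R * pi) = 0 :> R.
Proof.
have H (k : nat) : sin (k%:R * pi) = 0 :> R.
  by rewrite -[_ * _]add0r mulr_natl (alternatingn (@sinDpi R)) sin0 mulr0.
case: p => k; first exact: H.
by rewrite NegzE mulrNz mulNr sinN -pmulrn H oppr0.
Qed.

Lemma sin_eq0_int (x : R) : sin x = 0 -> exists p : int, x = p%:~R * pi.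
Proof.
move=> sx0; have pi0 := pi_gt0 R.
exists (Num.floor (x / pi)); set p := Num.floor _.
have /andP[pl pr] : p%:~R <= x / pi < (p + 1)%:~R.
  by rewrite floor_le_tmp// ?num_real//; apply: lt_succ_floor; rewrite num_real.
have : 0 <= x - p%:~R * pi < pi.
  rewrite subr_ge0 -ler_pdivlMr// pl /= ltrBlDr -[X in X + _]mul1r -mulrDl.
  by rewrite -ltr_pdivrMr// addrC (lt_le_trans pr)// intrD.
rewrite le_eqVlt => /andP[/orP[/eqP/esym/eqP|d0 dpi]].
  by rewrite subr_eq0 => /eqP.
have : 0 < sin (x - p%:~R * pi) by apply: sin_gt0_pi; rewrite d0 dpi.
by rewrite sinB sx0 sin_int_mulpi mul0r mulr0 subr0 ltxx.
Qed.

Lemma cos_eq1_int (x : R) : cos x = 1 -> exists p : int, x = p%:~R * (2 * pi).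
Proof.
have -> : x = (x / 2) *+ 2 by rewrite -mulr_natr divfK.
rewrite cos_mulr2n cos2sin2 => h.
have /sin_eq0_int[p ->] : sin (x / 2) = 0.
  by apply/eqP; rewrite -sqrf_eq0; apply/eqP; lra.
by exists p; rewrite -mulr_natr; ring.
Qed.

Lemma expC_eq u v : expC u = expC v -> exists p : int, u = v + p%:~R * tpi.
Proof.
move=> E; have ER : Re u = Re v.
  by apply: expR_inj; rewrite -!normc_expC E.
have e0 : expR (Re v) != 0 by rewrite gt_eqF// expR_gt0.
have [/(mulfI e0) cE /(mulfI e0) sE] :
    expR (Re v) * cos (Im u) = expR (Re v) * cos (Im v) /\
    expR (Re v) * sin (Im u) = expR (Re v) * sin (Im v).
  by move: E; rewrite /expC ER => -[].
have /cos_eq1_int[p pE] : cos (Im u - Im v) = 1.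
  by rewrite cosB cE sE -!expr2 cos2Dsin2.
exists p; rewrite -[p%:~R]/((p%:~R) : R[i]) -(rmorph_int (real_complex R)).
apply/eqP; rewrite eq_complex ReD ImD ReM ImM /= mulr0 !mul0r subr0 !addr0.
by rewrite ER eqxx -pE addrC subrK eqxx.
Qed.

Lemma expC_LogC_eq u z : z != 0 -> expC u = z ->
  exists p : int, u = LogC z + p%:~R * tpi.
Proof. by move=> z0 E; apply: expC_eq; rewrite expC_LogC. Qed.

Lemma LogC_conjc z : Im z != 0 -> LogC z^* = (LogC z)^*.
Proof.
move=> Iz; rewrite /LogC normc_conjc /argC Im_conjc Re_conjc normc_conjc /=.
congr (_ +i* _); rewrite oppr_ge0.
by case: ltgtP Iz => //= _ _; rewrite opprK.
Qed.

Lemma argCN z : Im z != 0 -> 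
  argC z = argC (- z) + (if 0 < Im z then pi else - pi).
Proof.
move=> Iz; rewrite /argC ImN ReN normcN mulNr oppr_ge0.
have := acosN (Re_div_normc_itv z).
by case: ltgtP Iz => //= _ _ ->; ring.
Qed.

Lemma LogCN z : Im z != 0 ->
  LogC z = LogC (- z) + (if 0 < Im z then tpi / 2 else - (tpi / 2)).
Proof.
move=> Iz; have E : tpi / 2 = 0 +i* pi.
  apply/eqP; rewrite -[2]/(2%:R : R[i]) -(rmorph_nat (real_complex R)) -fmorphV.
  rewrite eq_complex ReM ImM /= !mul0r !mulr0 subr0 add0r eqxx /=.
  by apply/eqP; field.
rewrite /LogC (argCN Iz) normcN E.
by case: ifP => _; apply/eqP; rewrite eq_complex /= ?oppr0 addr0 !eqxx.
Qed.

Lemma LogC_pos (r : R) : 0 < r -> LogC r%:C = (ln r)%:C.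
Proof.
move=> r0; rewrite /LogC /argC !normc_real gtr0_norm//= lexx.
by rewrite divff ?gt_eqF// acos1.
Qed.

Lemma LogC_neg (r : R) : r < 0 -> LogC r%:C = (ln (- r)) +i* pi.
Proof.
move=> r0; rewrite /LogC /argC !normc_real ltr0_norm//= lexx.
by rewrite invrN mulrN divff ?lt_eqF// acosN1.
Qed.

End ExpLog.

(** * Hoelder continuity of the logarithm *)

Section LogHoelder.
Variable R : realType.
Implicit Types (x y z u v a b : R[i]).

Lemma mul_cos_le_sin (k : R) : 0 <= k <= pi -> k * cos k <= sin k.
Proof.
move=> /andP[k0 kpi].
have [|c /[!in_itv]/= /andP[c0 ck]] := @MVT_segment R sin cos 0 k k0.
  by apply: continuous_subspaceT => t; exact: continuous_sin.
rewrite sin0 !subr0 => ->; rewrite mulrC; apply: ler_wpM2r => //.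
move: ck; rewrite le_eqVlt => /orP[/eqP->//|ck].
by rewrite ltW// ltr_cos// in_itv/= ?c0 ?k0 ?kpi// (le_trans (ltW ck)).
Qed.

(** sin h = 2 sin (h/2) cos (h/2) >= h cos^2 (h/2) = h (1 + cos h) / 2. *)
Lemma half_le_sin (h : R) : 0 <= h <= pi / 2 -> h / 2 <= sin h.
Proof.
move=> /andP[h0 hpi]; have pi0 := pi_gt0 R.
have ch0 : 0 <= cos h by apply: cos_ge0_pihalf; lra.
have k_itv : 0 <= h / 2 <= pi by lra.
have ck0 : 0 <= cos (h / 2) by apply: cos_ge0_pihalf; lra.
have := ler_wpM2r ck0 (mul_cos_le_sin k_itv).
have sE : sin h = 2 * (sin (h / 2) * cos (h / 2)).
  by rewrite -{1}[h](@divfK _ 2)// mulr_natr sin_mulr2n -mulr_natl; ring.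
have cE : cos h = 2 * (cos (h / 2) * cos (h / 2)) - 1.
  by rewrite -{1}[h](@divfK _ 2)// mulr_natr cos_mulr2n -mulr_natl expr2.
have : 0 <= h * cos h by rewrite mulr_ge0.
rewrite cE sE; nra.
Qed.

(** With s = acos x, t = acos y, m = (s+t)/2 and h = (s-t)/2,
    y - x = 2 sin m sin h >= 2 sin^2 h, because h <= m <= pi - h; and sin^2 h
    controls h^2. *)
Lemma acos_hoelder (x y : R) : -1 <= x <= 1 -> -1 <= y <= 1 ->
  (acos x - acos y) ^+ 2 <= 8 * `|x - y|.
Proof.
wlog xy : x y / acos y <= acos x => [H x1 y1|x1 y1].
  have [|/ltW] := leP (acos y) (acos x); first by move=> /H; exact.
  by move=> /H{}H; rewrite -sqrrN opprB distrC H.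
have := ler_norm (y - x); rewrite distrC -{1}(acosK x1) -{1}(acosK y1).
have := acos_lepi x1; have := acos_ge0 y1.
move: (acos x) (acos y) xy => s t ts t0 spi; have pi0 := pi_gt0 R.
pose m := (s + t) / 2; pose h := (s - t) / 2.
have hs : h / 2 <= sin h by apply: half_le_sin; rewrite /h; lra.
have hm : sin h <= sin m.
  have -> : sin m = sin (s / 2) * cos (t / 2) + cos (s / 2) * sin (t / 2).
    by rewrite -sinD; congr sin; rewrite /m; ring.
  have -> : sin h = sin (s / 2) * cos (t / 2) - cos (s / 2) * sin (t / 2).
    by rewrite -sinB; congr sin; rewrite /h; ring.
  have : 0 <= cos (s / 2) by apply: cos_ge0_pihalf; lra.
  have : 0 <= sin (t / 2) by apply: sin_ge0_pi; lra.
  nra.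
have -> : cos t - cos s = 2 * (sin m * sin h).
  have -> : t = m - h by rewrite /m /h; field.
  have -> : s = m + h by rewrite /m /h; field.
  by rewrite cosB cosD; ring.
have h0 : 0 <= h by rewrite /h; lra.
have -> : s - t = 2 * h by rewrite /h; field.
nra.
Qed.

Lemma Re_div_normc_dist a b : b != 0 -> normc b <= normc a ->
  `|Re a / normc a - Re b / normc b| <= 2 * (normc (a - b) / normc b).
Proof.
rewrite -normc_gt0 => b0 ba; have a0 := lt_le_trans b0 ba.
have -> : Re a / normc a - Re b / normc b =
  (Re (a - b) + Re a / normc a * (normc b - normc a)) / normc b.
  by rewrite ReB; field; rewrite !gt_eqF.
rewrite normf_div (gtr0_norm b0) mulrA ler_pM2r ?invr_gt0//.
rewrite mulr_natl mulr2n (le_trans (ler_normD _ _))// lerD ?Re_le_normc//.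
rewrite normrM -[leRHS]mul1r ler_pM// ?ler_norml ?Re_div_normc_itv//.
by rewrite -ler_norml distrC; exact: normcB_dist.
Qed.

Lemma argC_hoelder a b : b != 0 -> 0 <= Im a -> 0 <= Im b ->
  normc b <= normc a ->
  `|argC a - argC b| <= 4 * (Num.sqrt (normc (a - b)) / Num.sqrt (normc b)).
Proof.
move=> b0 Ia Ib ba.
rewrite -(ler_pXn2r (n := 2)) ?nnegrE ?normc_ge0 ?mulr_ge0// ?sqrtr_ge0//.
rewrite /argC Ia Ib real_normK ?num_real// exprMn expr_div_n.
rewrite !sqr_sqrtr ?normc_ge0//.
rewrite (le_trans (acos_hoelder _ _)) ?Re_div_normc_itv//.
have := Re_div_normc_dist b0 ba; lra.
Qed.

(** ln r = 2 ln (sqrt r), and ln (1 + x) <= x. *)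
Lemma ln_normc_hoelder a b : b != 0 -> normc b <= normc a ->
  `|ln (normc a) - ln (normc b)| <=
    2 * (Num.sqrt (normc (a - b)) / Num.sqrt (normc b)).
Proof.
rewrite -normc_gt0 => b0 ba; have a0 := lt_le_trans b0 ba.
have sb0 : 0 < Num.sqrt (normc b) by rewrite sqrtr_gt0.
have sa0 : 0 < Num.sqrt (normc a) by rewrite sqrtr_gt0.
have lnsq (r : R) : 0 < r -> ln r = 2 * ln (Num.sqrt r).
  by move=> r0; rewrite -{1}(sqr_sqrtr (ltW r0)) lnXn ?sqrtr_gt0// mulr_natl.
rewrite ger0_norm ?subr_ge0 ?ler_ln ?posrE//.
rewrite (lnsq (normc a))// (lnsq (normc b))// -mulrBr ler_wpM2l// -ln_div ?posrE//.
have -> : Num.sqrt (normc a) / Num.sqrt (normc b) =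
  1 + (Num.sqrt (normc a) - Num.sqrt (normc b)) / Num.sqrt (normc b).
  by field; rewrite gt_eqF.
have sab : Num.sqrt (normc b) <= Num.sqrt (normc a) by exact: ler_wsqrtr.
rewrite (le_trans (le_ln1Dx _))//.
  by rewrite (lt_le_trans (ltrN10 _))// divr_ge0 ?sqrtr_ge0// subr_ge0.
rewrite ler_pM2r ?invr_gt0//.
rewrite -(ler_pXn2r (n := 2)) ?nnegrE ?sqrtr_ge0 ?subr_ge0//.
rewrite sqr_sqrtr ?normc_ge0// (le_trans _ (normcB_ge _ _))//.
rewrite -{2}(sqr_sqrtr (ltW a0)) -{2}(sqr_sqrtr (ltW b0)).
move: (Num.sqrt _) (Num.sqrt _) sa0 sb0 sab => s t s0 t0 st; nra.
Qed.

(** On the closed upper half-plane without 0 the logarithm is Hoelder continuous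
    with exponent 1/2, with a constant that explodes like |.|^(-1/2) at 0. The
    exponent 1/2 is chosen because this singularity stays integrable along
    every ray, uniformly in the direction. *)
Lemma LogC_hoelder a b : a != 0 -> b != 0 -> 0 <= Im a -> 0 <= Im b ->
  normc (LogC a - LogC b) <= 6 * Num.sqrt (normc (a - b)) *
    ((Num.sqrt (normc a))^-1 + (Num.sqrt (normc b))^-1).
Proof.
wlog ba : a b / normc b <= normc a => [H a0 b0 Ia Ib|a0 b0 Ia Ib].
  have [|/ltW] := leP (normc b) (normc a); first by move=> /H; exact.
  by move=> /H{}H; rewrite normcBC [normc (a - b)]normcBC [_^-1 + _]addrC H.
rewrite (le_trans (normc_le_ReIm _))// ReB ImB/=.
have := argC_hoelder b0 Ia Ib ba; have := ln_normc_hoelder b0 ba.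
have : 0 <= Num.sqrt (normc (a - b)) / Num.sqrt (normc a).
  by rewrite divr_ge0 ?sqrtr_ge0.
rewrite mulrDr -!mulrA; lra.
Qed.

End LogHoelder.

(** * The integral of an inverse square root *)

Section InvSqrt.
Variable R : realType.
Local Notation mu := (@lebesgue_measure R).
Implicit Types (c t d : R).

(** A continuous regularization of |t - c|^(-1/2). *)
Definition invsqrt c d t : R := (Num.sqrt (`|t - c| + d))^-1.

Lemma invsqrt_ge0 c d t : 0 <= invsqrt c d t.
Proof. by rewrite invr_ge0 sqrtr_ge0. Qed.

Lemma continuous_invsqrt c d : 0 < d -> continuous (invsqrt c d).
Proof.
move=> d0 t; rewrite /invsqrt.
apply: (@continuousV _ _ (fun t => Num.sqrt (`|t - c| + d))).
  by rewrite gt_eqF// sqrtr_gt0 ltr_wpDl.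
apply: (@continuous_comp _ _ _ (fun t => `|t - c| + d) Num.sqrt).
  apply: (@continuousD _ _ _ (fun t => `|t - c|) (fun=> d)).
    apply: (@continuous_comp _ _ _ (fun t => t - c) (@Num.norm R R)).
      apply: (@continuousB _ _ _ id (fun=> c)); [exact: cvg_id|exact: cst_continuous].
    exact: norm_continuous.
  exact: cst_continuous.
exact: sqrt_continuous.
Qed.

Lemma measurable_invsqrt c d (D : set R) : 0 < d -> measurable_fun D (invsqrt c d).
Proof.
move=> d0; apply: measurable_funTS; apply: continuous_measurable_fun.
exact: continuous_invsqrt.
Qed.

(** On one side of c, where s (t - c) >= 0 with s = 1 or s = -1, the function
    2 s sqrt (s (t - c) + d) is a primitive. *)
Lemma int_invsqrt_side s a b c d : s ^+ 2 = 1 -> 0 < d <= 1 -> a <= b ->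
  (forall t, a <= t <= b -> 0 <= s * (t - c) <= 1) ->
  (\int[mu]_(t in `[a, b]) (invsqrt c d t)%:E <= 3%:E)%E.
Proof.
move=> s2 /andP[d0 d1]; rewrite le_eqVlt => /orP[/eqP<- _|ab H].
  by rewrite set_itv1 integral_set1 lee_fin.
pose g t := s * (t - c) + d.
pose F t := 2 * s * Num.sqrt (g t).
have gpos t : a <= t <= b -> 0 < g t by move=> /H ?; rewrite /g; lra.
have dg t : is_derive t 1 g s.
  by rewrite /g; apply: is_derive_eq; rewrite /GRing.scale/=; ring.
have cF : continuous F.
  move=> t; apply: (@continuousM _ _ (fun=> 2 * s) (fun t => Num.sqrt (g t))).
    exact: cst_continuous.
  apply: (@continuous_comp _ _ _ g Num.sqrt); last exact: sqrt_continuous.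
  by apply/differentiable_continuous/derivable1_diffP; case: (dg t).
have dF t : t \in `]a, b[ -> is_derive t 1 F (invsqrt c d t).
  rewrite in_itv/= => /andP[/ltW at_ /ltW tb].
  have tab : a <= t <= b by rewrite at_ tb.
  have dsg : is_derive t 1 (Num.sqrt \o g) ((2 * Num.sqrt (g t))^-1 * s).
    by apply: is_derive1_comp; apply: is_derive1_sqrt; exact: gpos.
  have dF0 : is_derive t 1 ((2 * s) *: (Num.sqrt \o g))
    ((2 * s) *: ((2 * Num.sqrt (g t))^-1 * s)) by exact: is_deriveZ.
  apply: is_derive_eq; rewrite /GRing.scale/=.
  have /andP[st0 _] := H _ tab.
  have -> : invsqrt c d t = (Num.sqrt (g t))^-1.
    rewrite /invsqrt /g; congr (Num.sqrt (_ + _))^-1.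
    by rewrite -[RHS]ger0_norm// normrM -[`|s|]sqrtr_sqr s2 sqrtr1 mul1r.
  have sq0 : Num.sqrt (g t) != 0 by rewrite gt_eqF// sqrtr_gt0 gpos.
  have -> : 2 * s * ((2 * Num.sqrt (g t))^-1 * s) = s ^+ 2 * (Num.sqrt (g t))^-1.
    by field.
  by rewrite s2 mul1r.
rewrite (@continuous_FTC2 _ _ F)//.
- rewrite -EFinB lee_fin /F.
  have g2 t : a <= t <= b -> Num.sqrt (g t) <= 3 / 2.
    move=> tab; have /andP[g0 g1] := H _ tab.
    rewrite -[3 / 2]ger0_norm ?divr_ge0// -sqrtr_sqr ler_wsqrtr// /g; lra.
  have gb2 : Num.sqrt (g b) <= 3 / 2 by apply: g2; rewrite lexx ltW.
  have ga2 : Num.sqrt (g a) <= 3 / 2 by apply: g2; rewrite lexx ltW.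
  have := sqrtr_ge0 (g a); have := sqrtr_ge0 (g b).
  have : (s == 1) || (s == -1) by rewrite -eqf_sqr s2 expr1n.
  by move=> /orP[] /eqP ->; lra.
- by apply: continuous_subspaceT; exact: continuous_invsqrt.
- split; first by move=> t /dF[].
    by apply: cvg_at_right_filter; exact: cF.
  by apply: cvg_at_left_filter; exact: cF.
- by move=> t tab; rewrite derive1E; case: (dF _ tab).
Qed.

Lemma int_invsqrt c d : 0 < d <= 1 ->
  (\int[mu]_(t in `[0%R, 1%R]) (invsqrt c d t)%:E <= 6%:E)%E.
Proof.
move=> d01; have /andP[d0 d1] := d01.
wlog c01 : c / 0 <= c <= 1 => [H|].
  (* moving c to the nearest point of the interval only increases the integrand *)
  pose c' := if c < 0 then 0 else if 1 < c then 1 else c.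
  have c'01 : 0 <= c' <= 1.
    rewrite /c'; case: ltP => c0; rewrite ?lexx ?ler01//.
    by case: ltP => c1; rewrite ?lexx ?ler01// c0 c1.
  apply: le_trans (H c' c'01); apply: ge0_le_integral => //.
  - by move=> t _; rewrite lee_fin invsqrt_ge0.
  - by apply/measurable_EFinP; exact: measurable_invsqrt.
  - by apply/measurable_EFinP; exact: measurable_invsqrt.
  - move=> t /=; rewrite in_itv/= => /andP[t0 t1]; rewrite lee_fin.
    rewrite lef_pV2 ?posrE ?sqrtr_gt0 ?ltr_wpDl// ler_wsqrtr// lerD2r.
    rewrite /c'; case: ltP => c0.
      by rewrite subr0 (ger0_norm t0) ger0_norm; lra.
    case: ltP => c1 //.
    by rewrite (distrC t) (distrC t) ger0_norm ?subr_ge0// ger0_norm; lra.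
have /andP[c0 c1] := c01.
rewrite (@itv_bndbnd_setU _ _ (BLeft 0) (BRight c) (BRight 1)) ?bnd_simp//.
rewrite ge0_integral_setU//=.
- rewrite [leRHS](_ : _ = 3%:E + 3%:E)%E; last by rewrite -EFinD; congr EFin; ring.
  apply: leeD.
    apply: (@int_invsqrt_side (-1)); rewrite ?sqrrN ?expr1n//.
    move=> t /andP[t0 t1]; lra.
  rewrite integral_itv_obnd_cbnd; last first.
    by apply/measurable_EFinP; exact: measurable_invsqrt.
  apply: (@int_invsqrt_side 1); rewrite ?expr1n//.
  by move=> t /andP[t0 t1]; lra.
- by apply/measurable_EFinP; exact: measurable_invsqrt.
- by move=> t _; rewrite lee_fin invsqrt_ge0.
- apply/disj_setPS => t /=; rewrite !in_itv/= => -[/andP[_ tc] /andP[ct _]].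
  by move: (lt_le_trans ct tc); rewrite ltxx.
Qed.

(** |t - c|^(-1/2) with value +oo at t = c: a bound by this function may fail
    there, so that no exceptional point has to be discarded from the estimates. *)
Definition invsqrte c t : \bar R :=
  limn (fun n => (invsqrt c (n.+1%:R^-1) t)%:E).

Lemma invsqrt_nd c t :
  nondecreasing_seq (fun n => (invsqrt c (n.+1%:R^-1) t)%:E).
Proof.
move=> m n mn; rewrite lee_fin lef_pV2 ?posrE ?sqrtr_gt0 ?ltr_wpDl ?invr_gt0//.
by rewrite ler_wsqrtr// lerD2l lef_pV2 ?posrE// ler_nat.
Qed.

(** The factor 2 absorbs the regularization: d <= |t - c| for small d. *)
Lemma le_invsqrte c t x : (t != c -> x <= (Num.sqrt (2 * `|t - c|))^-1) ->
  (x%:E <= invsqrte c t)%E.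
Proof.
move=> H.
have le_lim n : ((invsqrt c (n.+1%:R^-1) t)%:E <= invsqrte c t)%E.
  rewrite /invsqrte; apply: lime_ge.
    exact/ereal_nondecreasing_is_cvgn/invsqrt_nd.
  by exists n => // m /= nm; exact: invsqrt_nd.
have [e e0 He] : exists2 e : R, 0 < e &
    forall d, 0 < d <= e -> x <= invsqrt c d t.
  have [tc|tc] := eqVneq t c.
    exists (((`|x| + 1) ^+ 2)^-1); first by rewrite invr_gt0 exprn_gt0// ltr_wpDl.
    move=> d /andP[d0 de]; rewrite /invsqrt tc subrr normr0 add0r.
    rewrite (le_trans (ler_norm x))// (@le_trans _ _ (`|x| + 1)) ?lerDl//.
    rewrite -[`|x| + 1]invrK lef_pV2 ?posrE ?sqrtr_gt0 ?invr_gt0 ?ltr_wpDl//.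
    by rewrite -[leRHS]ger0_norm ?invr_ge0 ?addr_ge0// -sqrtr_sqr exprVn ler_wsqrtr.
  exists `|t - c|; first by rewrite normr_gt0 subr_eq0.
  move=> d /andP[d0 de]; rewrite (le_trans (H tc))// lef_pV2 ?posrE ?sqrtr_gt0.
  - by rewrite ler_wsqrtr// mulr_natl mulr2n lerD2l.
  - by rewrite mulr_gt0// normr_gt0 subr_eq0.
  - by rewrite ltr_wpDl.
have [n en] : exists n, n.+1%:R^-1 <= e.
  exists (Num.trunc e^-1); rewrite -[leRHS]invrK lef_pV2 ?posrE ?invr_gt0//.
  by rewrite ltW// truncnS_gt.
apply: le_trans (le_lim n); rewrite lee_fin; apply: He.
by rewrite invr_gt0 ltr0n en.
Qed.

Lemma measurable_invsqrte c (D : set R) : measurable D ->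
  measurable_fun D (invsqrte c).
Proof.
move=> mD; apply: (emeasurable_fun_cvg
  (fun n t => (invsqrt c (n.+1%:R^-1) t)%:E)) => [n|t _].
  by apply/measurable_EFinP; apply: measurable_invsqrt; rewrite invr_gt0.
exact/ereal_nondecreasing_is_cvgn/invsqrt_nd.
Qed.

Lemma invsqrte_ge0 c t : (0 <= invsqrte c t)%E.
Proof. by apply: le_invsqrte => _; rewrite invr_ge0 sqrtr_ge0. Qed.

Lemma int_invsqrte c : (\int[mu]_(t in `[0%R, 1%R]) invsqrte c t <= 6%:E)%E.
Proof.
rewrite monotone_convergence//.
- apply: lime_le.
    apply: ereal_nondecreasing_is_cvgn => m n mn; apply: ge0_le_integral => //.
    + by move=> t _; rewrite lee_fin invsqrt_ge0.
    + by apply/measurable_EFinP; apply: measurable_invsqrt; rewrite invr_gt0.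
    + by apply/measurable_EFinP; apply: measurable_invsqrt; rewrite invr_gt0.
    + by move=> t _; exact: invsqrt_nd.
  apply: nearW => n; apply: int_invsqrt.
  by rewrite invr_gt0 ltr0n/= invf_le1// ler1n.
- by move=> n; apply/measurable_EFinP; apply: measurable_invsqrt; rewrite invr_gt0.
- by move=> n t _; rewrite lee_fin invsqrt_ge0.
- by move=> t _; exact: invsqrt_nd.
Qed.

End InvSqrt.

(** * Hoelder continuity of the polylogarithms on a closed half-plane *)

Section LiHoelder.
Variable R : realType.
Local Notation mu := (@lebesgue_measure R).
Implicit Types (z w : R[i]) (t A K M : R) (f : R[i] -> R[i]).

(** What is left of the modulus of continuity of [log_hoelder] at tz after
    division by t, up to a factor independent of t. *)
Definition ray_kernel z t : R :=
  (Num.sqrt t)^-1 * (Num.sqrt (normc (1 - t%:C * z)))^-1.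

Lemma normc_1B_ge z t : 0 <= t -> `|1 - t * normc z| <= normc (1 - t%:C * z).
Proof.
move=> t0; have -> : t * normc z = normc (t%:C * z).
  by rewrite normcM normc_real ger0_norm.
by rewrite -[X in `|X - _|](@normc1 R); exact: normcB_dist.
Qed.

(** Where t|z| <= 1/2 the second factor is bounded; elsewhere
    t^(-1/2) |1 - t|z||^(-1/2) = (t|z|)^(-1/2) |t - 1/|z||^(-1/2), and the first
    factor is bounded. *)
Lemma ray_kernel_le z t : 0 < t -> t != (normc z)^-1 ->
  ray_kernel z t <=
  2 * ((Num.sqrt (2 * `|t - 0|))^-1 + (Num.sqrt (2 * `|t - (normc z)^-1|))^-1).
Proof.
move=> t0 tc; set r := normc z in tc *.
have r0 : 0 <= r by exact: normc_ge0.
have s2 : 0 < Num.sqrt 2 :> R by rewrite sqrtr_gt0.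
have s22 : Num.sqrt 2 * Num.sqrt 2 = 2 :> R by rewrite -expr2 sqr_sqrtr.
rewrite subr0 (gtr0_norm t0) !sqrtrM// !invfM.
have st : 0 < Num.sqrt t by rewrite sqrtr_gt0.
have e2 : 2 * (Num.sqrt 2)^-1 = Num.sqrt 2 :> R.
  by rewrite -{1}s22 mulfK ?gt_eqF.
rewrite mulrDr !mulrA e2.
have [tr|tr] := leP (t * r) (2^-1).
  have h : (Num.sqrt (normc (1 - t%:C * z)))^-1 <= Num.sqrt 2.
    rewrite -[leRHS]invrK lef_pV2 ?posrE ?invr_gt0//.
      rewrite -sqrtrV// ler_wsqrtr// (le_trans _ (normc_1B_ge _ _)) ?(ltW t0)//.
      by rewrite ger0_norm -/r; lra.
    rewrite sqrtr_gt0 (lt_le_trans _ (normc_1B_ge _ (ltW t0)))// normr_gt0 -/r.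
    by rewrite subr_eq0 gt_eqF//; lra.
  apply: (@le_trans _ _ ((Num.sqrt t)^-1 * Num.sqrt 2)).
    by rewrite /ray_kernel ler_wpM2l// invr_ge0 ltW.
  by rewrite mulrC lerDl mulr_ge0// ?invr_ge0 sqrtr_ge0.
have rp : 0 < r.
  rewrite lt_neqAle r0 andbT; apply/eqP => r00.
  by move: tr; rewrite -r00 mulr0; lra.
have E : `|1 - t * r| = r * `|t - r^-1|.
  rewrite -{2}(gtr0_norm rp) -normrM distrC; congr `|_|.
  by field; rewrite gt_eqF.
have d0 : 0 < `|t - r^-1| by rewrite normr_gt0 subr_eq0.
apply: (@le_trans _ _ ((Num.sqrt (t * r))^-1 * (Num.sqrt `|t - r^-1|)^-1)).
  have -> : (Num.sqrt (t * r))^-1 / Num.sqrt `|t - r^-1| =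
      (Num.sqrt t)^-1 * (Num.sqrt `|1 - t * r|)^-1.
    by rewrite E sqrtrM ?(ltW t0)// sqrtrM ?(ltW rp)// !invfM mulrA.
  apply: ler_wpM2l; first by rewrite invr_ge0 ltW.
  have q0 : 0 < `|1 - t * r| by rewrite E mulr_gt0.
  have q := normc_1B_ge z (ltW t0).
  rewrite lef_pV2 ?posrE ?sqrtr_gt0 ?(lt_le_trans q0 q)//.
  exact: ler_wsqrtr.
apply: (@le_trans _ _ (Num.sqrt 2 * (Num.sqrt `|t - r^-1|)^-1)).
  rewrite ler_wpM2r ?invr_ge0 ?sqrtr_ge0// -[leRHS]invrK.
  rewrite lef_pV2 ?posrE ?invr_gt0 ?sqrtr_gt0 ?mulr_gt0//.
  by rewrite -sqrtrV// ler_wsqrtr// ltW.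
by rewrite lerDr mulr_ge0// ?invr_ge0 sqrtr_ge0.
Qed.

(** An integrable majorant of the kernels of z and w, infinite at their
    singularities. *)
Definition ray_kernele z w t : \bar R :=
  (invsqrte 0 t + invsqrte (normc z)^-1 t + (invsqrte 0 t + invsqrte (normc w)^-1 t))%E.

Lemma le_ray_kernele z w t x A : 0 < A -> 0 <= t ->
  (t != 0 -> t != (normc z)^-1 -> t != (normc w)^-1 ->
    x <= A * (ray_kernel z t + ray_kernel w t)) ->
  (x%:E <= (2 * A)%:E * ray_kernele z w t)%E.
Proof.
move=> A0 t0 H; have A2 : 0 < 2 * A by rewrite mulr_gt0.
rewrite -[x](@mulfVK _ (2 * A)) ?gt_eqF// mulrC EFinM.
rewrite lee_pmul2l ?lte_fin//; set y := x / _.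
have top c : t = c -> (y%:E <= invsqrte c t)%E.
  by move=> ->; apply: le_invsqrte; rewrite eqxx.
have ge0 := @invsqrte_ge0 R.
have [/top tE|t_0] := eqVneq t 0.
  by rewrite /ray_kernele (le_trans tE)// -addeA leeDl// !adde_ge0.
have [/top tE|tz] := eqVneq t (normc z)^-1.
  rewrite /ray_kernele (le_trans tE)// -addeA addeCA leeDl// !adde_ge0//.
have [/top tE|tw] := eqVneq t (normc w)^-1.
  by rewrite /ray_kernele (le_trans tE)// addeA leeDr// !adde_ge0.
have tp : 0 < t by rewrite lt_neqAle eq_sym t_0.
have := H t_0 tz tw; rewrite mulrC -ler_pdivrMr// => Hy.
have : y <= (Num.sqrt (2 * `|t - 0|))^-1 + (Num.sqrt (2 * `|t - (normc z)^-1|))^-1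
   + ((Num.sqrt (2 * `|t - 0|))^-1 + (Num.sqrt (2 * `|t - (normc w)^-1|))^-1).
  have := ray_kernel_le tp tz; have := ray_kernel_le tp tw => h1 h2.
  by rewrite /y invfM [2^-1 * _]mulrC mulrA ler_pdivrMr//; lra.
rewrite -lee_fin => /le_trans; apply.
by rewrite !EFinD /ray_kernele; do 2 ! apply: leeD; apply: le_invsqrte.
Qed.

Lemma measurable_ray_kernele z w (D : set R) : measurable D ->
  measurable_fun D (ray_kernele z w).
Proof.
by move=> mD; apply: emeasurable_funD; apply: emeasurable_funD;
  exact: measurable_invsqrte.
Qed.

Lemma int_ray_kernele z w :
  (\int[mu]_(t in `[0%R, 1%R]) ray_kernele z w t <= 24%:E)%E.
Proof.
have ge0 := @invsqrte_ge0 R.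
rewrite ge0_integralD//; last 4 first.
- by move=> t _; rewrite adde_ge0.
- by apply: emeasurable_funD; exact: measurable_invsqrte.
- by move=> t _; rewrite adde_ge0.
- by apply: emeasurable_funD; exact: measurable_invsqrte.
rewrite !ge0_integralD//; try exact: measurable_invsqrte.
rewrite (_ : 24%:E = (6%:E + 6%:E) + (6%:E + 6%:E))%E.
  by do 2 ! apply: leeD; exact: int_invsqrte.
by rewrite -!EFinD; congr EFin; ring.
Qed.

(** The constant does not depend on z and w: the position of the singularity on
    the ray moves with z, but the integral of the kernel stays bounded. *)
Lemma dominated01 (g : R -> R) A z w : 0 < A ->
  measurable_fun `[(0 : R), 1] g ->
  (forall t, 0 <= t <= 1 -> t != 0 -> t != (normc z)^-1 -> t != (normc w)^-1 ->
    `|g t| <= A * (ray_kernel z t + ray_kernel w t)) ->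
  mu.-integrable `[(0 : R), 1] (EFin \o g) /\ `|\int[mu]_(t in `[0, 1]) g t| <= 48 * A.
Proof.
move=> A0 mg H.
have A2 : 0 <= 2 * A by rewrite mulr_ge0 ?ltW.
have mge : measurable_fun `[(0 : R), 1] (EFin \o g) by exact/measurable_EFinP.
have ub : (\int[mu]_(t in `[0%R, 1%R]) `|(g t)%:E| <= (48 * A)%:E)%E.
  apply: (@le_trans _ _ (\int[mu]_(t in `[0%R, 1%R]) ((2 * A)%:E * ray_kernele z w t))%E).
    apply: ge0_le_integral => //.
    - exact: measurableT_comp.
    - by apply: measurable_funeM; exact: measurable_ray_kernele.
    - move=> t /=; rewrite in_itv/= => t01; apply: le_ray_kernele => //.
        by case/andP: t01.
      exact: H.
  rewrite ge0_integralZl//.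
  - rewrite (_ : (48 * A)%:E = (2 * A)%:E * 24%:E)%E; last first.
      by rewrite -EFinM; congr EFin; ring.
    by rewrite lee_wpmul2l ?lee_fin// int_ray_kernele.
  - exact: measurable_ray_kernele.
  - by move=> t _; rewrite !adde_ge0// invsqrte_ge0.
have ig : mu.-integrable `[(0 : R), 1] (EFin \o g).
  by apply/integrableP; split => //; rewrite (le_lt_trans ub)// ltry.
split => //; rewrite -lee_fin (le_trans _ ub)// EFin_normr_Rintegral//.
exact: le_abse_integral.
Qed.

(** The modulus of continuity of Li_1 on the closed lower half-plane; it is kept
    by the recursion defining Li_k. *)
Definition log_hoelder f := forall M, exists2 K, 0 < K & forall z w,
  Im z <= 0 -> Im w <= 0 -> normc z <= M -> normc w <= M -> z != 1 -> w != 1 ->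
  normc (f z - f w) <= K * Num.sqrt (normc (z - w)) *
    ((Num.sqrt (normc (1 - z)))^-1 + (Num.sqrt (normc (1 - w)))^-1).

Definition hoelder f := forall M, exists2 K, 0 < K & forall z w,
  Im z <= 0 -> Im w <= 0 -> normc z <= M -> normc w <= M ->
  normc (f z - f w) <= K * Num.sqrt (normc (z - w)).

Lemma hoelder_log f : hoelder f -> log_hoelder f.
Proof.
move=> H M; have [K K0 HK] := H M.
have K1 : 0 < K * Num.sqrt (1 + `|M|).
  by rewrite mulr_gt0// sqrtr_gt0 ltr_wpDr.
exists (K * Num.sqrt (1 + `|M|)) => // z w Iz Iw zM wM z1 w1.
rewrite (le_trans (HK z w _ _ _ _))// -[leLHS]mulr1 -!mulrA.
rewrite ler_wpM2l ?(ltW K0)// mulrCA ler_wpM2l ?sqrtr_ge0//.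
have n0 : 0 < normc (1 - z) by rewrite normc_gt0 subr_eq0 eq_sym.
apply: (@le_trans _ _ (Num.sqrt (1 + `|M|) * (Num.sqrt (normc (1 - z)))^-1)).
  rewrite ler_pdivlMr ?sqrtr_gt0// mul1r ler_wsqrtr//.
  rewrite (le_trans (le_normcD _ _))// normc1 normcN lerD2l (le_trans zM)//.
  exact: ler_norm.
by rewrite ler_wpM2l ?sqrtr_ge0// lerDl invr_ge0 sqrtr_ge0.
Qed.

Lemma Li1E z : Li 1 z = - LogC (1 - z). Proof. by []. Qed.

Lemma log_hoelder_Li1 : log_hoelder (Li 1).
Proof.
move=> M; exists 6 => // z w Iz Iw _ _ z1 w1.
rewrite !Li1E opprK addrC (le_trans (LogC_hoelder _ _ _ _)) ?subr_eq0 1?eq_sym//.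
- by rewrite ImB /= sub0r oppr_ge0.
- by rewrite ImB /= sub0r oppr_ge0.
- have -> : 1 - w - (1 - z) = z - w by ring.
  by rewrite [X in _ * X <= _]addrC.
Qed.

Lemma Re_divr (x : R[i]) t : Re (x / t%:C) = Re x / t.
Proof. by rewrite -fmorphV ReM /= mulr0 subr0. Qed.
Lemma Im_divr (x : R[i]) t : Im (x / t%:C) = Im x / t.
Proof. by rewrite -fmorphV ImM /= mulr0 add0r. Qed.

Lemma Im_mulr (x : R[i]) t : Im (t%:C * x) = t * Im x.
Proof. by rewrite ImM /= mul0r addr0. Qed.
Lemma Re_mulr (x : R[i]) t : Re (t%:C * x) = t * Re x.
Proof. by rewrite ReM /= mul0r subr0. Qed.

Lemma normc_mulr (x : R[i]) t : 0 <= t -> normc (t%:C * x) = t * normc x.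
Proof. by move=> t0; rewrite normcM normc_real ger0_norm. Qed.

Lemma mul_ray_neq1 z t : t != (normc z)^-1 -> 0 <= t -> t%:C * z != 1.
Proof.
move=> tc t0; apply: contraNneq tc => E.
have := congr1 (@normc R) E; rewrite normc_mulr// normc1 => H.
have z0 : normc z != 0 by apply: contra_eq_neq H => ->; rewrite mulr0 eq_sym oner_neq0.
by apply/eqP; rewrite -[RHS]mul1r -H mulfK.
Qed.

(** What is used of the real and imaginary parts, so as to treat both at once. *)
Definition realpart (part : R[i] -> R) :=
  [/\ forall x y, part (x - y) = part x - part y,
      forall x, `|part x| <= normc x &
      forall x t, part (x / t%:C) = part x / t].

(** The function is continuous off the points t = 0 and t = 1/|z|, the only
    point where tz can be 1. *)
Lemma measurable_ray f part z : log_hoelder f -> realpart part -> Im z <= 0 ->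
  measurable_fun `[(0 : R), 1] (fun t => part (f (t%:C * z) / t%:C)).
Proof.
move=> Hf [partB partN partV] Iz; set c := (normc z)^-1; set r := normc z.
have r0 : 0 <= r by exact: normc_ge0.
(* an open set containing what remains of [0, 1] without 0 and c *)
pose U : set R := `]0, 2[ `&` ~` [set c].
have [K K0 HK] := Hf (2 * r).
suff mU : measurable_fun U (fun t => part (f (t%:C * z) / t%:C)).
  have mU' : measurable_fun (U `|` ([set 0] `|` [set c]))
      (fun t => part (f (t%:C * z) / t%:C)).
    apply/measurable_funU => //.
    - by apply: measurableI => //; exact: measurableC.
    - exact: measurableU.
    - split => //; apply/measurable_funU => //.
      by split; exact: measurable_fun_set1.
  apply: measurable_funS mU'.
    by apply: measurableU; [apply: measurableI => //; exact: measurableC|exact: measurableU].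
  move=> t /=; rewrite in_itv/= => /andP[t0 t1].
  have [->|t_0] := eqVneq t 0; first by right; left.
  have [->|t_c] := eqVneq t c; first by right; right.
  left; split; last by move=> /= /eqP; rewrite (negPf t_c).
  by rewrite /= in_itv/= lt_neqAle eq_sym t_0 t0/= (le_lt_trans t1)// ltr1n.
have oU : open U.
  apply: openI; first exact: interval_open.
  apply: closed_openC; exact: closed_eq.
apply: open_continuous_measurable_fun => // t0; rewrite inE => Ut0.
have Uneq t : U t -> t%:C * z != 1.
  move=> [/= ]; rewrite in_itv/= => /andP[tp _] tc.
  by apply: mul_ray_neq1; [apply/eqP|exact: ltW].
have Upos t : U t -> 0 < t < 2 by move=> [/=]; rewrite in_itv.
have Une t : U t -> 1 - t * r != 0.
  move=> Ut; have /andP[tp _] := Upos _ Ut; rewrite subr_eq0 eq_sym.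
  apply/eqP => E; case: Ut => _; apply => /=; rewrite /c -/r.
  have rn : r != 0 by apply: contra_eq_neq E => ->; rewrite mulr0 eq_sym oner_neq0.
  by rewrite -[RHS]mul1r -E mulfK.
under eq_fun do rewrite partV.
apply: cvgM; last first.
  by apply: cvgV; [have /andP[/gt_eqF ->] := Upos _ Ut0|exact: cvg_id].
pose B t := K * Num.sqrt (`|t0 - t| * r) *
  ((Num.sqrt `|1 - t0 * r|)^-1 + (Num.sqrt `|1 - t * r|)^-1).
have Bc : B t @[t --> t0] --> B t0.
  apply: cvgM.
    apply: cvgMr; apply: continuous_cvg; first exact: sqrt_continuous.
    apply: cvgMl; apply: cvg_norm; apply: cvgB; [exact: cvg_cst|exact: cvg_id].
  apply: cvgD; first exact: cvg_cst.
  apply: cvgV; first by rewrite sqrtr_eq0 -ltNge normr_gt0 Une.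
  apply: continuous_cvg; first exact: sqrt_continuous.
  apply: cvg_norm; apply: cvgB; first exact: cvg_cst.
  by apply: cvgMl; exact: cvg_id.
have B0 : B t0 = 0 by rewrite /B subrr normr0 mul0r sqrtr0 mulr0 mul0r.
apply/cvgrPdist_le => e e0.
move/cvgrPdist_le : Bc => /(_ _ e0); rewrite B0.
have Un : \forall t \near t0, U t by exact: open_nbhs_nbhs.
apply: filterS2 Un => t Ut; rewrite sub0r normrN => Be.
apply: le_trans Be; rewrite -partB (le_trans (partN _))//.
apply: le_trans (ler_norm _).
have /andP[tp t2] := Upos _ Ut; have /andP[t0p t02] := Upos _ Ut0.
rewrite (le_trans (HK _ _ _ _ _ _ _ _)) ?Uneq//.
- by rewrite Im_mulr mulr_ge0_le0 // ltW.
- by rewrite Im_mulr mulr_ge0_le0 // ltW.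
- by rewrite (normc_mulr _ (ltW t0p)) (ler_wpM2r r0)// ltW.
- by rewrite (normc_mulr _ (ltW tp)) (ler_wpM2r r0)// ltW.
- rewrite -mulrBl -rmorphB normcM normc_real -/r /B.
  rewrite ler_wpM2l ?mulr_ge0 ?sqrtr_ge0 ?(ltW K0)//.
  have inv x : U x -> (Num.sqrt (normc (1 - x%:C * z)))^-1 <= (Num.sqrt `|1 - x * r|)^-1.
    move=> Ux; have /andP[/ltW xp _] := Upos _ Ux.
    rewrite lef_pV2 ?posrE ?sqrtr_gt0 ?normc_gt0 ?normr_gt0 ?Une//.
      by rewrite ler_wsqrtr// normc_1B_ge.
    by rewrite subr_eq0 eq_sym Uneq.
  by apply: lerD; apply: inv.
Qed.

(** The operator that takes Li_(k-1) to Li_k. *)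
Definition ray_int f z : R[i] := integralC01 (fun t => f (t%:C * z) / t%:C).

Lemma realpart_Re : realpart (@complex.Re R).
Proof. by split; [exact: ReB|exact: Re_le_normc|exact: Re_divr]. Qed.
Lemma realpart_Im : realpart (@complex.Im R).
Proof. by split; [exact: ImB|exact: Im_le_normc|exact: Im_divr]. Qed.

Lemma normc_ray_diff f K M z w t :
  (forall z w, Im z <= 0 -> Im w <= 0 -> normc z <= M -> normc w <= M ->
    z != 1 -> w != 1 ->
    normc (f z - f w) <= K * Num.sqrt (normc (z - w)) *
    ((Num.sqrt (normc (1 - z)))^-1 + (Num.sqrt (normc (1 - w)))^-1)) ->
  Im z <= 0 -> Im w <= 0 -> normc z <= M -> normc w <= M ->
  0 <= t <= 1 -> t != 0 -> t != (normc z)^-1 -> t != (normc w)^-1 ->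
  normc (f (t%:C * z) / t%:C - f (t%:C * w) / t%:C) <=
  K * Num.sqrt (normc (z - w)) * (ray_kernel z t + ray_kernel w t).
Proof.
move=> HK Iz Iw zM wM /andP[t0 t1] tn tz tw.
have tp : 0 < t by rewrite lt_neqAle eq_sym tn.
rewrite -mulrBl normcM normcV normc_real ger0_norm// ler_pdivrMr//.
have st : Num.sqrt t * Num.sqrt t = t by rewrite -expr2 sqr_sqrtr.
rewrite (le_trans (HK _ _ _ _ _ _ _ _)) ?mul_ray_neq1//.
- by rewrite Im_mulr mulr_ge0_le0.
- by rewrite Im_mulr mulr_ge0_le0.
- by rewrite normc_mulr// (le_trans _ zM)// ler_piMl// normc_ge0.
- by rewrite normc_mulr// (le_trans _ wM)// ler_piMl// normc_ge0.
- rewrite -mulrBr normc_mulr// sqrtrM// /ray_kernel -mulrDr -[X in _ <= _ * X]st.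
  rewrite le_eqVlt; apply/orP; left; apply/eqP.
  by move: (_^-1 + _^-1) => S; field; rewrite gt_eqF ?sqrtr_gt0.
Qed.

Lemma integrable_ray f part z : log_hoelder f -> f 0 = 0 -> realpart part ->
  Im z <= 0 ->
  mu.-integrable `[(0 : R), 1] (EFin \o (fun t => part (f (t%:C * z) / t%:C))).
Proof.
move=> Hf f0 Hpart Iz; have [partB partN partV] := Hpart.
have [K K0 HK] := Hf (normc z).
have A0 : 0 < K * Num.sqrt (normc (z - 0)) + 1.
  by rewrite ltr_wpDl// mulr_ge0 ?sqrtr_ge0 ?ltW.
have [//|t t01 tn tz tw|//] :=
  @dominated01 (fun t => part (f (t%:C * z) / t%:C)) _ z 0 A0.
  exact: (measurable_ray Hf Hpart Iz).
rewrite (le_trans (partN _))//.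
have := @normc_ray_diff f K (normc z) z 0 t HK Iz _ (lexx _) _ t01 tn tz tw.
rewrite mulr0 f0 mul0r subr0 normc0 normc_ge0 => /(_ (lexx _) isT) /le_trans; apply.
rewrite ler_wpM2r ?lerDl// addr_ge0// mulr_ge0// invr_ge0 sqrtr_ge0.
Qed.

(** |f(tz) - f(tw)| / t <= K sqrt |z - w| times the kernels of z and w:
    the factor sqrt t gained from |tz - tw| makes 1/t integrable at 0. *)
Lemma hoelder_ray_int f : log_hoelder f -> f 0 = 0 -> hoelder (ray_int f).
Proof.
move=> Hf f0 M; have [K K0 HK] := Hf M.
exists (96 * K); first by rewrite mulr_gt0.
move=> z w Iz Iw zM wM.
have [->|zw] := eqVneq z w; first by rewrite !subrr !normc0 sqrtr0 mulr0.
have A0 : 0 < K * Num.sqrt (normc (z - w)).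
  by rewrite mulr_gt0// sqrtr_gt0 normc_gt0 subr_eq0.
have H part : realpart part ->
  `|\int[mu]_(t in `[0, 1]) part (f (t%:C * z) / t%:C) -
    \int[mu]_(t in `[0, 1]) part (f (t%:C * w) / t%:C)| <=
  48 * (K * Num.sqrt (normc (z - w))).
  move=> Hpart; have [partB partN partV] := Hpart.
  rewrite -RintegralB//;
    [|exact: (integrable_ray Hf f0 Hpart Iz)|exact: (integrable_ray Hf f0 Hpart Iw)].
  apply: (@dominated01 _ _ z w A0 _ _).2.
    by apply: measurable_funB;
      [exact: (measurable_ray Hf Hpart Iz)|exact: (measurable_ray Hf Hpart Iw)].
  move=> t t01 tn tz tw; rewrite -partB (le_trans (partN _))//.
  exact: normc_ray_diff HK _ _ _ _ _ _ _ _.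
rewrite (le_trans (normc_le_ReIm _))// ReB ImB /=.
by have := H _ realpart_Re; have := H _ realpart_Im; lra.
Qed.

Lemma LiE k z : Li k.+2 z = ray_int (Li k.+1) z.
Proof. by []. Qed.

Lemma Rintegral01_0 (g : R -> R) : (forall t, g t = 0) ->
  \int[mu]_(t in `[0, 1]) g t = 0.
Proof.
move=> g0; rewrite (@eq_Rintegral _ _ _ _ _ (fun=> 0)); last by move=> t _.
by rewrite Rintegral_cst ?mul0r.
Qed.

Lemma LogC1 : LogC 1 = 0 :> R[i].
Proof. by rewrite (@LogC_pos R 1)// ln1. Qed.

Lemma Li_0 k : Li k 0 = 0 :> R[i].
Proof.
case: k => [//|]; elim => [|k IH]; first by rewrite /= subr0 LogC1 oppr0.
rewrite LiE /ray_int /integralC01 !Rintegral01_0// => t.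
  by rewrite mulr0 IH mul0r.
by rewrite mulr0 IH mul0r.
Qed.

(** On the closed lower half-plane Li_k is continuous up to the cut: there the
    value on the cut, as given by the integral and the main branch, is the limit
    from below. *)
Lemma log_hoelder_Li k : log_hoelder (Li k.+1).
Proof.
elim: k => [|k IH]; first exact: log_hoelder_Li1.
by apply: hoelder_log; exact: (hoelder_ray_int IH (Li_0 _)).
Qed.

Lemma integrable_Li_ray k part z : realpart part -> Im z <= 0 ->
  mu.-integrable `[(0 : R), 1] (EFin \o (fun t => part (Li k.+1 (t%:C * z) / t%:C))).
Proof.
by move=> Hp Iz; exact: (integrable_ray (@log_hoelder_Li k) (Li_0 _) Hp Iz).
Qed.

End LiHoelder.

(** * Boundary values of the polylogarithms *)

Local Arguments Li : simpl never.

Section LiBoundary.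
Variable R : realType.
Local Notation mu := (@lebesgue_measure R).
Implicit Types (z w : R[i]) (t x : R).

Lemma RintegralN01 (g : R -> R) : mu.-integrable `[(0 : R), 1] (EFin \o g) ->
  \int[mu]_(t in `[0, 1]) (- g t) = - \int[mu]_(t in `[0, 1]) g t.
Proof.
move=> ig; rewrite -mulN1r -RintegralZl//.
by apply: eq_Rintegral => t _; rewrite mulN1r.
Qed.

Lemma conjc_divr z t : (z / t%:C)^* = z^* / t%:C.
Proof.
apply/eqP; rewrite eq_complex Re_conjc Im_conjc !Re_divr !Im_divr.
by rewrite Re_conjc Im_conjc mulNr !eqxx.
Qed.

Lemma conjc_mulr z t : (t%:C * z)^* = t%:C * z^*.
Proof.
apply/eqP; rewrite eq_complex Re_conjc Im_conjc !Re_mulr !Im_mulr.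
by rewrite Re_conjc Im_conjc mulrN !eqxx.
Qed.

Lemma Li_conjc_lower k z : Im z < 0 -> Li k.+1 z^* = (Li k.+1 z)^*.
Proof.
elim: k z => [|k IH] z Iz.
  have E : 1 - z^* = (1 - z)^* by rewrite rmorphB rmorph1.
  rewrite !Li1E E LogC_conjc ?rmorphN//.
  by rewrite ImB /= sub0r oppr_eq0 lt_eqF.
rewrite !LiE /ray_int.
have E t : t \in `[(0:R), 1]%classic ->
    Li k.+1 (t%:C * z^*) / t%:C = (Li k.+1 (t%:C * z) / t%:C)^*.
  rewrite inE /= in_itv/= => /andP[t0 _].
  have [->|tn] := eqVneq t 0; first by rewrite !mul0r !Li_0 !mul0r rmorph0.
  have tp : 0 < t by rewrite lt_neqAle eq_sym tn.
  rewrite conjc_divr -IH; last by rewrite Im_mulr pmulr_rlt0.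
  by rewrite conjc_mulr.
have ER : \int[mu]_(t in `[0, 1]) Re (Li k.+1 (t%:C * z^*) / t%:C) =
    \int[mu]_(t in `[0, 1]) Re (Li k.+1 (t%:C * z) / t%:C).
  by apply: eq_Rintegral => t t01; rewrite (E t t01) Re_conjc.
have EI : \int[mu]_(t in `[0, 1]) Im (Li k.+1 (t%:C * z^*) / t%:C) =
    - \int[mu]_(t in `[0, 1]) Im (Li k.+1 (t%:C * z) / t%:C).
  rewrite -(@RintegralN01 (fun t => Im (Li k.+1 (t%:C * z) / t%:C))).
    by apply: eq_Rintegral => t t01; rewrite (E t t01) Im_conjc.
  exact: integrable_Li_ray (@realpart_Im R) (ltW Iz).
by rewrite /integralC01 ER EI.
Qed.

(** Conjugation exchanges the two half-planes, so that the limit of Li_k from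
    above at a real point is the conjugate of its value. *)
Lemma Li_conjc k z : Im z != 0 -> Li k.+1 z^* = (Li k.+1 z)^*.
Proof.
case: ltgtP => // Iz _; first exact: Li_conjc_lower.
rewrite -{2}[z]conjcK [in RHS]Li_conjc_lower ?conjcK//.
by rewrite Im_conjc oppr_lt0.
Qed.

Lemma oneB_real x : 1 - x%:C = (1 - x)%:C :> R[i].
Proof. by rewrite rmorphB rmorph1. Qed.

Lemma Im_Li_lt1 k x : x < 1 -> Im (Li k.+1 x%:C) = 0.
Proof.
elim: k x => [|k IH] x x1.
  by rewrite Li1E oneB_real LogC_pos ?subr_gt0//= oppr0.
rewrite LiE /ray_int /integralC01 /=.
transitivity (\int[mu]_(t in `[(0:R), 1]) (0 : R)); last exact: Rintegral01_0.
apply: eq_Rintegral => t; rewrite inE/= in_itv/= => /andP[t0 t1].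
rewrite Im_divr -rmorphM/= IH ?mul0r//.
have [x0|x0] := leP 0 x; first by rewrite (le_lt_trans _ x1)// ler_piMl.
by rewrite (le_lt_trans _ ltr01)// mulr_ge0_le0// ltW.
Qed.

(** The imaginary part of Li_(k+1) on the cut. *)
Definition cut_im k x : R := - pi * (ln x ^+ k / k`!%:R).

Lemma is_derive_cut_im k x t : 0 < x -> 0 < t ->
  is_derive t 1 (fun t => cut_im k.+1 (t * x)) (cut_im k (t * x) / t).
Proof.
move=> x0 t0; pose g t := ln (t * x).
have dm : is_derive t 1 (fun t => t * x) x.
  by apply: is_derive_eq; rewrite /GRing.scale/= mulr1 mulr0 add0r.
have dg : is_derive t 1 g t^-1.
  have dl : is_derive (t * x) 1 (@ln R) (t * x)^-1.
    by apply: is_derive1_ln; rewrite mulr_gt0.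
  have -> : t^-1 = (t * x)^-1 * x by field; rewrite !gt_eqF.
  exact: is_derive1_comp.
pose c : R := - pi / k.+1`!%:R.
have -> : (fun t => cut_im k.+1 (t * x)) = c *: (g ^+ k.+1).
  by apply/funext => s; rewrite /cut_im /c /g !fctE /GRing.scale/=; ring.
apply: is_derive_eq.
rewrite /GRing.scale/= /cut_im /c /g factS natrM.
have f0 : k`!%:R != 0 :> R by exact: fact_neq0.
have k0 : k.+1%:R != 0 :> R by rewrite pnatr_eq0.
move: (k.+1%:R) k0 => q q0.
by field; rewrite f0 q0 gt_eqF.
Qed.

(** The integrand is real for t < 1/x, and for t > 1/x its imaginary part is the
    derivative of t |-> cut_im (k+1) (tx), which vanishes at t = 1/x. *)
Lemma Im_Li_gt1 k x : 1 < x -> Im (Li k.+1 x%:C) = cut_im k x.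
Proof.
elim: k x => [|k IH] x x1.
  rewrite Li1E oneB_real LogC_neg ?subr_lt0//=.
  by rewrite /cut_im expr0 divr1 mulr1.
have x0 : 0 < x by rewrite (lt_trans ltr01).
pose c := x^-1; have c0 : 0 < c by rewrite invr_gt0.
have c1 : c < 1 by rewrite invf_lt1.
set g := fun t => Im (Li k.+1 (t%:C * x%:C) / t%:C).
have ig : mu.-integrable `[(0:R), 1] (EFin \o g).
  by apply: integrable_Li_ray; [exact: realpart_Im|rewrite /= lexx].
have igS (D : set R) : measurable D -> D `<=` `[0, 1] ->
    mu.-integrable D (EFin \o g).
  by move=> mD D01; apply: integrableS ig.
rewrite LiE /ray_int /integralC01 [LHS]/= -/g.
have E : `[(0:R), 1]%classic = `[0, c] `|` `]c, 1].
  by rewrite (@itv_bndbnd_setU _ _ (BLeft 0) (BRight c) (BRight 1)) ?bnd_simp// ltW.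
rewrite E Rintegral_setU//; last 2 first.
- by rewrite -E.
- rewrite disj_set2E; apply/eqP; rewrite -subset0 => t [/=].
  by rewrite !in_itv/= => /andP[_ tc] /andP[/lt_le_trans/(_ tc)]; rewrite ltxx.
rewrite -Rintegral_itv_bndo_bndc; last first.
  by apply: igS => // t /=; rewrite !in_itv/= => /andP[-> /ltW/le_trans->]//; exact: ltW.
rewrite (@eq_Rintegral _ _ _ _ _ (fun=> 0)); last first.
  move=> t; rewrite inE/= in_itv/= => /andP[t0 tc].
  by rewrite /g Im_divr -rmorphM/= Im_Li_lt1 ?mul0r// -ltr_pdivlMr// div1r.
rewrite Rintegral_cst ?mul0r ?add0r//.
set h := fun t => cut_im k (t * x) / t.
have gh t : c < t -> g t = h t.
  by move=> ct; rewrite /g Im_divr -rmorphM/= IH// -ltr_pdivrMr// div1r.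
transitivity (\int[mu]_(t in `]c, 1]) h t).
  by apply: eq_Rintegral => t; rewrite inE/= in_itv/= => /andP[ct _]; exact: gh.
have hpos t : t \in `[c, 1] -> 0 < t.
  by rewrite in_itv/= => /andP[ct _]; exact: lt_le_trans ct.
have dF t : 0 < t -> is_derive t 1 (fun t => cut_im k.+1 (t * x)) (h t).
  exact: is_derive_cut_im.
have cF t : 0 < t -> {for t, continuous (fun t => cut_im k.+1 (t * x))}.
  move=> t0; apply/differentiable_continuous/derivable1_diffP.
  by case: (dF t t0).
have ch : {within `[c, 1], continuous h}.
  apply: continuous_in_subspaceT => t; rewrite inE => /hpos t0.
  apply: cvgM; last by apply: cvgV; [rewrite gt_eqF|exact: cvg_id].
  rewrite /cut_im; apply: cvgMr; apply: cvgMl.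
  have cl : {for t, continuous (fun t => ln (t * x))}.
    apply: continuous_cvg; first by apply: continuous_ln; rewrite mulr_gt0.
    by apply: cvgMl; exact: cvg_id.
  elim: (k) => [|j IHj]; first by under eq_fun do rewrite expr0; exact: cvg_cst.
  by under eq_fun do rewrite exprS; rewrite exprS; apply: cvgM.
have ih : mu.-integrable `[c, 1] (EFin \o h).
  by apply: continuous_compact_integrable => //; exact: segment_compact.
rewrite Rintegral_itv_obnd_cbnd; last first.
  apply: integrableS ih => // t /=; rewrite !in_itv/= => /andP[/ltW -> ->] //.
rewrite /Rintegral (@continuous_FTC2 _ _ (fun t => cut_im k.+1 (t * x)))//=.
- by rewrite mul1r mulVf ?gt_eqF// {2}/cut_im ln1 expr0n mul0r mulr0 subr0.
- split; first by move=> t /[!in_itv]/= /andP[ct _]; case: (dF t (lt_trans c0 ct)).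
    by apply: cvg_at_right_filter; exact: cF.
  by apply: cvg_at_left_filter; exact: cF.
- move=> t /[!in_itv]/= /andP[ct _]; rewrite derive1E.
  by case: (dF t (lt_trans c0 ct)).
Qed.

Lemma Li_conj_lt1 k x : x < 1 -> (Li k.+1 x%:C)^* = Li k.+1 x%:C.
Proof.
by move=> /(Im_Li_lt1 k); case: (Li _ _) => a b /= ->; rewrite oppr0.
Qed.

(** As the limit from above is the conjugate of the limit from below, this is the
    jump of Li_(k+1) across its cut. *)
Lemma Li_conj_gt1 k x : 1 < x ->
  (Li k.+1 x%:C)^* = Li k.+1 x%:C + two_pi_i R * ((ln x)%:C ^+ k / k`!%:R).
Proof.
move=> /(Im_Li_gt1 k); rewrite -(rmorphXn (real_complex R)).
rewrite -(rmorph_nat (real_complex R)) -fmorphV -rmorphM/=.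
case: (Li _ _) => a b /= ->; apply/eqP; rewrite eq_complex /= mul0r mulr0 subrr.
by rewrite addr0 eqxx /= /cut_im; apply/eqP; ring.
Qed.

End LiBoundary.

(** * Congruences modulo kappa *)

Section KappaCongruence.

Lemma odd_exp (a : int) m : exists b : int, (2 * a + 1) ^+ m = 2 * b + 1.
Proof.
elim: m => [|m [b IH]]; first by exists 0; rewrite expr0 mulr0.
by exists (2 * a * b + a + b); rewrite exprS IH; ring.
Qed.

Lemma exp1_mod (N k : int) m : exists l : int, (1 + k * N) ^+ m = 1 + l * N.
Proof.
elim: m => [|m [l IH]]; first by exists 0; rewrite expr0 mul0r addr0.
by exists (l + k + k * l * N); rewrite exprS IH; ring.
Qed.

(** (2a+1)^2 - 1 = 4a(a+1) is divisible by 8, and each further squaring gains a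
    factor 2. *)
Lemma odd_exp_2exp (a : int) j :
  exists k : int, (2 * a + 1) ^+ (2 ^ j.+1) = 1 + k * 2 ^+ j.+3.
Proof.
elim: j => [|j [k IH]].
  have [b Hb] : exists b : int, a * (a + 1) = 2 * b.
    have [b [->|->]] : exists b, a = 2 * b \/ a = 2 * b + 1.
    - by exists (a %/ 2)%Z; lia.
    - by exists (b * (2 * b + 1)); ring.
    - by exists ((2 * b + 1) * (b + 1)); ring.
  exists b; transitivity (1 + 4 * (a * (a + 1))); first by ring.
  by rewrite Hb; ring.
exists (k + k * k * 2 ^+ j.+2); rewrite expnSr exprM IH.
by rewrite !exprS; ring.
Qed.

(** An exponent e such that 2^e divides every difference of m-th powers of odd
    integers. *)
Definition kappa_exp m : nat := (if odd m then 1 else 2 + logn 2 m)%N.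

Lemma odd_exp_sub (a b : int) m : (0 < m)%N ->
  exists k : int, (2 * a + 1) ^+ m - (2 * b + 1) ^+ m = k * 2 ^+ kappa_exp m.
Proof.
move=> m0; rewrite /kappa_exp; case: ifPn => om.
  have [a' ->] := odd_exp a m; have [b' ->] := odd_exp b m.
  by exists (a' - b'); ring.
have v0 : (0 < logn 2 m)%N by rewrite logn_gt0 mem_primes m0 dvdn2 om.
have [s ms] : exists s, m = (2 ^ (logn 2 m).-1.+1 * s)%N.
  rewrite prednK//; have /dvdnP[s ms] := pfactor_dvdnn 2 m.
  by exists s; rewrite mulnC.
move: (logn 2 m) v0 ms => [//|v] _ /= ms.
have H (c : int) : exists k : int, (2 * c + 1) ^+ m = 1 + k * 2 ^+ v.+3.
  by have [k E] := odd_exp_2exp c v; rewrite ms exprM E; exact: exp1_mod.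
have [k ->] := H a; have [l ->] := H b.
by exists (k - l); rewrite add2n; ring.
Qed.

Variable R : realType.

Lemma kappaE n : (1 < n)%N ->
  kappa R n = (2 ^+ kappa_exp n.-1 / 2 ^+ n.-1).
Proof.
case: n => // m m0; rewrite /kappa /kappa_exp /= if_neg.
have two : (2 : R[i]) != 0 by rewrite pnatr_eq0.
case: ifP => om.
  rewrite (_ : 2 - m.+1%:Z = 1%:Z + - m%:Z); last by lia.
  by rewrite expfzDr// -exprnN.
rewrite (_ : 3 + _ - _ = (2 + logn 2 m)%:Z + - m%:Z); last by lia.
by rewrite expfzDr// -exprnN.
Qed.

(** The m-th powers, m = n-1, of two half-odd numbers agree modulo kappa_n: this
    is where kappa_n comes from. *)
Lemma half_odd_exp_sub n (a b : int) : (1 < n)%N -> exists k : int,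
  (a%:~R + 2^-1) ^+ n.-1 - (b%:~R + 2^-1) ^+ n.-1 = k%:~R * kappa R n.
Proof.
move=> n1; have m0 : (0 < n.-1)%N by case: n n1.
have [k Hk] := odd_exp_sub a b m0; exists k.
have E (c : int) : (c%:~R + 2^-1 : R[i]) ^+ n.-1 =
    ((2 * c + 1) ^+ n.-1)%:~R / 2 ^+ n.-1.
  by rewrite rmorphXn/= -expr_div_n rmorphD rmorphM /=; congr (_ ^+ _); field.
by rewrite !E -mulrBl -rmorphB Hk kappaE// rmorphM rmorphXn /= mulrA.
Qed.

End KappaCongruence.

(** * The functions on the components *)

Section Component.
Variable R : realType.
Implicit Types (x y : hatC R) (z u v c L : R[i]) (n k m : nat).
Local Notation tpi := (two_pi_i R).

Lemma tpiE : tpi = 'i%C * (2 * pi)%:C.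
Proof. by apply/eqP; rewrite eq_complex ReM ImM /=; apply/andP; split; apply/eqP; ring. Qed.

Lemma tpi_neq0 : tpi != 0.
Proof.
rewrite eq_complex /= negb_and orbC mulf_neq0 ?pnatr_eq0// gt_eqF//.
exact: pi_gt0.
Qed.

Lemma ReIm_tpiX n (r : R) : ReIm n (tpi ^+ n * r%:C) = 0.
Proof. by rewrite tpiE exprMn -mulrA -rmorphXn -rmorphM ReIm_imX_real. Qed.

Lemma rC_neq0 x : rC x != 0.
Proof. by rewrite mulf_neq0 ?expC_neq0// signr_eq0. Qed.

Lemma oneB_rC x : 1 - rC x = (-1) ^+ neg2 x * expC (vC x).
Proof. by rewrite [RHS](canRL (addKr _) (hatC_eq x)) addrC. Qed.

Lemma rC_neq1 x : rC x != 1.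
Proof.
by rewrite eq_sym -subr_eq0 oneB_rC mulf_neq0 ?expC_neq0// signr_eq0.
Qed.

Lemma normc_sign (b : bool) z : normc ((-1) ^+ b * z) = normc z.
Proof. by case: b; rewrite ?expr1 ?expr0 ?mulN1r ?mul1r ?normcN. Qed.

Lemma Re_uC x : Re (uC x) = ln (normc (rC x)).
Proof. by rewrite /rC normc_sign normc_expC expRK. Qed.

Lemma Re_vC x : Re (vC x) = ln (normc (1 - rC x)).
Proof. by rewrite oneB_rC normc_sign normc_expC expRK. Qed.

Lemma pC_spec x :
  uC x = LogC ((-1) ^+ neg1 x * rC x) + (pC x)%:~R * tpi.
Proof.
apply: (@xgetPex _ 0 [set p : int |
    uC x = LogC ((-1) ^+ neg1 x * rC x) + p%:~R * tpi]).
apply: expC_LogC_eq; first by rewrite mulf_neq0 ?rC_neq0// signr_eq0.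
by rewrite /rC signrMK.
Qed.

Lemma qC_spec x :
  vC x = LogC ((-1) ^+ neg2 x * (1 - rC x)) + (qC x)%:~R * tpi.
Proof.
apply: (@xgetPex _ 0 [set q : int |
    vC x = LogC ((-1) ^+ neg2 x * (1 - rC x)) + q%:~R * tpi]).
apply: expC_LogC_eq.
  by rewrite mulf_neq0 ?signr_eq0// subr_eq0 eq_sym rC_neq1.
by rewrite oneB_rC signrMK.
Qed.

Lemma ladder_eq (lam lam' : nat -> R[i]) u v n :
  (forall k, lam k.+1 = lam' k.+1) -> ladder lam u v n = ladder lam' u v n.
Proof.
move=> E; rewrite /ladder; congr (_ - _); apply: eq_bigr => r _.
have : (0 < n - r)%N by rewrite subn_gt0.
by case: (n - r)%N => // k _; rewrite E.
Qed.

(** The binomial theorem: adding c L^k / k! to lam (k+1), which is how calLi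
    differs from Li and how Li jumps across its cut, adds c (L - u)^m / m!. *)
Lemma ladder_shift (lam lam' : nat -> R[i]) u v c L m :
  (forall k, lam' k.+1 = lam k.+1 + c * (L ^+ k / k`!%:R)) ->
  ladder lam' u v m.+1 = ladder lam u v m.+1 + c * ((L - u) ^+ m / m`!%:R).
Proof.
move=> E; rewrite /ladder addrAC; congr (_ - _).
rewrite [L - u]addrC -/(exp_coef (- u + L) m) -cauchy_exp mulr_sumr -big_split/=.
apply: eq_bigr => r _; rewrite subSn -1?ltnS// E /exp_coef.
by rewrite [(- u) ^+ _]exprNn; ring.
Qed.

Lemma hatL_formula_ladder x n :
  hatL_formula n.+1 x = ladder (fun k => Li k (rC x)) (uC x) (vC x) n.+1
  - (qC x)%:~R * tpi * ((LogC (rC x) - uC x) ^+ n / n`!%:R).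
Proof.
rewrite -mulNr -(@ladder_shift _ (fun k => calLi k (rC x) (qC x)))//.
by move=> k; rewrite /calLi; ring.
Qed.

(** exp (Log z - u) is a sign, so its square is 1. *)
Lemma LogC_rC_half x :
  exists k : int, LogC (rC x) - uC x = k%:~R * (tpi / 2).
Proof.
have [k Hk] : exists k : int, (LogC (rC x) - uC x) + (LogC (rC x) - uC x) =
    0 + k%:~R * tpi.
  have E : expC (LogC (rC x)) = (-1) ^+ neg1 x * expC (uC x).
    by rewrite expC_LogC ?rC_neq0.
  have E2 : expC (LogC (rC x) - uC x) = (-1) ^+ neg1 x.
    apply: (mulIf (expC_neq0 (uC x))); rewrite -E -expCD; congr expC; ring.
  apply: expC_eq; rewrite expCD E2 -expr2 sqrr_sign.
  by rewrite /expC /= expR0 cos0 sin0 mulr1 mulr0.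
exists k; move: Hk; rewrite add0r => Hk; by rewrite mulrA -Hk; field.
Qed.

(** q contributes q 2 pi i (Log z - u)^(n-1) / (n-1)!, a rational multiple of
    (2 pi i)^n. *)
Lemma ReIm_hatL_formula x n : (0 < n)%N ->
  ReIm n (hatL_formula n x) =
  ReIm n (ladder (fun k => Li k (rC x)) (uC x) (vC x) n).
Proof.
case: n => // n _; rewrite hatL_formula_ladder ReImB.
have [k ->] := LogC_rC_half x.
rewrite [X in _ - ReIm _ X](_ : _ = tpi ^+ n.+1 *
    ((qC x)%:~R * ((k%:~R / 2) ^+ n / n`!%:R))%:C); last first.
  rewrite !rmorphM !rmorphXn !rmorphM !fmorphV !rmorph_int !rmorph_nat exprS.
  by rewrite !exprMn; ring.
by rewrite ReIm_tpiX subr0.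
Qed.

(** The element of index 1 is v - Log (1-z), where exp v is 1-z up to sign. *)
Lemma Re_ladder1 x : Re (ladder (fun k => Li k (rC x)) (uC x) (vC x) 1) = 0.
Proof.
rewrite /ladder big_ord1 /= !expr0 !divr1 mul1r !mulr1 expr1 mulN1r opprK.
by rewrite subn0 ReD Li1E ReN /= Re_vC addNr.
Qed.

(** A representative modulo kappa_n (2 pi i)^n / (n-1)! of hat L_n on the
    component (-,-) in which p and q no longer occur: it depends on (u,v) and on
    the values of the polylogarithms only. The fraction (v + lam 1) / (2 pi i) + 1/2
    is an integer, q or q+1 according to the sign of Im z. *)
Definition normal_form n (lam : nat -> R[i]) u v : R[i] :=
  ladder lam u v n
  - period R n * ((v + lam 1%N) / tpi + 2^-1) * 2^-1 ^+ n.-1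
  + period R n * (- 2^-1) ^+ n.-1.

(** Above the real axis Log z - u = (1/2 - p) 2 pi i, below it
    (-1/2 - p) 2 pi i; in either case its (n-1)-st power may be replaced by that
    of pi i, by [half_odd_exp_sub]. The correction terms in the definition of
    hat L_n compensate for the jump of v - Log (1-z). *)
Lemma hatL_mm_normal n x : (1 < n)%N -> neg1 x -> neg2 x -> Im (rC x) != 0 ->
  exists k : int, hatL_mm n x =
    normal_form n (fun k => Li k (rC x)) (uC x) (vC x)
    + k%:~R * (kappa R n * period R n).
Proof.
case: n => // m n1 x1 x2 Iz.
rewrite /hatL_mm hatL_formula_ladder /normal_form Li1E.
have u_ := pC_spec x; have v_ := qC_spec x.
move: u_ v_; rewrite x1 x2 expr1 !mulN1r.
set p := pC x; set q := qC x; set z := rC x in Iz * => u_ v_.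
have tpi0 := tpi_neq0.
have Iz1 : Im (1 - z) != 0 by rewrite ImB /= sub0r oppr_eq0.
have := LogCN Iz; have := LogCN Iz1; rewrite ImB /= sub0r oppr_gt0.
rewrite /period [_.+1.-1]/=.
have [k1 Hk1] := half_odd_exp_sub R (- p) 0 n1.
have [k2 Hk2] := half_odd_exp_sub R (- p - 1) 0 n1.
move: Hk1 Hk2; rewrite /= add0r.
have -> : (- p)%:~R + 2^-1 = 2^-1 - p%:~R :> R[i] by rewrite rmorphN addrC.
have -> : (- p - 1)%:~R + 2^-1 = - p%:~R - 2^-1 :> R[i].
  by rewrite rmorphB rmorphN /=; field.
move=> /(canRL (subrK _)) Hk1 /(canRL (subrK _)) Hk2.
case: ltgtP Iz => // Iz _ L1 L.
- have hE : LogC z - uC x = (- p%:~R - 2^-1) * tpi by rewrite L u_; field.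
  have qE : (vC x - LogC (1 - z)) / tpi + 2^-1 = q%:~R by rewrite L1 v_; field.
  exists (- (q * k2)); rewrite hE qE exprMn Hk2 rmorphN rmorphM /= exprS.
  by field; exact: fact_neq0.
- have hE : LogC z - uC x = (2^-1 - p%:~R) * tpi by rewrite L u_; field.
  have qE : (vC x - LogC (1 - z)) / tpi + 2^-1 = q%:~R + 1 by rewrite L1 v_; field.
  exists (- (q * k1) - k2); rewrite hE qE exprMn Hk1 Hk2 rmorphB rmorphN rmorphM /=.
  by rewrite exprS; field; exact: fact_neq0.
Qed.

Lemma rC_real x : Im (rC x) = 0 -> rC x = (Re (rC x))%:C.
Proof. by case: (rC x) => a b /= ->. Qed.

(** Conjugating the polylogarithms amounts to passing from the limit below to
    the limit above the real axis. For z > 1 their jumps add up to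
    2 pi i (Log z - u)^(n-1) / (n-1)!, partly compensated by the explicit
    occurrence of Li_1; the difference is a multiple of kappa_n by
    [half_odd_exp_sub]. *)
Lemma normal_form_conj n x : (1 < n)%N -> neg1 x -> Im (rC x) = 0 ->
  exists k : int,
    normal_form n (fun k => (Li k (rC x))^*) (uC x) (vC x) =
    normal_form n (fun k => Li k (rC x)) (uC x) (vC x)
    + k%:~R * (kappa R n * period R n).
Proof.
case: n => // m n1 x1 /rC_real; set r := Re _ => zE.
have r1 : r != 1.
  by have := rC_neq1 x; rewrite zE; apply: contra_neq => ->.
rewrite /normal_form zE.
case: (ltgtP r 1) r1 => // r1 _.
  exists 0; rewrite mul0r addr0 (Li_conj_lt1 0)//; congr (_ - _ + _).
  by apply: ladder_eq => k; exact: Li_conj_lt1.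
have r0 : 0 < r by rewrite (lt_trans ltr01).
rewrite (@ladder_shift (fun k => Li k r%:C) _ _ _ tpi (ln r)%:C); last first.
  by move=> k; exact: Li_conj_gt1.
rewrite (Li_conj_gt1 0)// expr0 divr1 mulr1.
have := pC_spec x; rewrite x1 expr1 mulN1r zE.
rewrite -rmorphN LogC_neg ?oppr_lt0// opprK; set p := pC x => u_.
have [k] := half_odd_exp_sub R (- p - 1) 0 n1; rewrite /= add0r.
have -> : (- p - 1)%:~R + 2^-1 = - p%:~R - 2^-1 :> R[i].
  by rewrite rmorphB rmorphN /=; field.
move=> /(canRL (subrK _)) Hk.
have hE : (ln r)%:C - uC x = (- p%:~R - 2^-1) * tpi.
  rewrite u_ (_ : _ +i* _ = (ln r)%:C + tpi / 2); first by field.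
  apply/eqP; rewrite -[2]/(2%:R : R[i]) eq_complex ReD ImD -(rmorph_nat (real_complex R)).
  by rewrite Re_divr Im_divr /= mul0r addr0 add0r eqxx /=; apply/eqP; field.
exists k; rewrite hE exprMn Hk /period /= exprS; have := tpi_neq0 => tpi0.
by field; rewrite tpi0 fact_neq0.
Qed.

Lemma ReIm_kappa_period n (k : int) : (1 < n)%N ->
  ReIm n (k%:~R * (kappa R n * period R n)) = 0.
Proof.
move=> n1; rewrite kappaE//.
rewrite [X in ReIm n X](_ : _ = tpi ^+ n *
  (k%:~R * (2 ^+ kappa_exp n.-1 / 2 ^+ n.-1) / n.-1`!%:R)%:C) ?ReIm_tpiX//.
rewrite !rmorphM !fmorphV !rmorphXn rmorph_int !rmorph_nat /period; ring.
Qed.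

Lemma ReIm_period n (r : R) : ReIm n (period R n * r%:C) = 0.
Proof.
rewrite [X in ReIm n X](_ : _ = tpi ^+ n * (r / n.-1`!%:R)%:C) ?ReIm_tpiX//.
by rewrite rmorphM fmorphV rmorph_nat /period; ring.
Qed.

Lemma ReIm_hatL_mm n x : (0 < n)%N ->
  ReIm n (hatL_mm n x) =
  ReIm n (ladder (fun k => Li k (rC x)) (uC x) (vC x) n).
Proof.
move=> n0; rewrite /hatL_mm ReImD ReIm_hatL_formula//.
rewrite [X in _ + X](_ : _ = 0) ?addr0//; case: ifP => _.
  rewrite -(ReIm_period n (- (- (pC x)%:~R - 2^-1) ^+ n.-1 + (- 2^-1) ^+ n.-1)).
  congr (ReIm n (_ * _)).
  by rewrite rmorphD rmorphN !rmorphXn rmorphB !rmorphN fmorphV rmorph_int rmorph_nat.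
rewrite -(ReIm_period n ((- 2^-1) ^+ n.-1)).
by congr (ReIm n (_ * _)); rewrite rmorphXn rmorphN fmorphV rmorph_nat.
Qed.

Lemma vC_Li1_half x : exists k : int,
  (vC x + Li 1 (rC x)) / tpi = k%:~R / 2.
Proof.
have n1 : 1 - rC x != 0 by rewrite subr_eq0 eq_sym rC_neq1.
have [k Hk] : exists k : int, (vC x + Li 1 (rC x)) + (vC x + Li 1 (rC x)) =
    0 + k%:~R * tpi.
  have E : expC (vC x + Li 1 (rC x)) = (-1) ^+ neg2 x.
    apply: (mulIf n1); rewrite -{1}(expC_LogC n1) -expCD Li1E addrNK oneB_rC.
    by rewrite signrMK.
  apply: expC_eq; rewrite expCD E -expr2 sqrr_sign.
  by rewrite /expC /= expR0 cos0 sin0 mulr1 mulr0.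
exists k; have := tpi_neq0; move: Hk; rewrite add0r => Hk t0.
apply: (mulIf t0); rewrite divfK// [RHS]mulrAC -Hk; by field.
Qed.

Lemma ReIm_normal_form n x : (1 < n)%N ->
  ReIm n (normal_form n (fun k => Li k (rC x)) (uC x) (vC x)) =
  ReIm n (ladder (fun k => Li k (rC x)) (uC x) (vC x) n).
Proof.
move=> n1; rewrite /normal_form; have [k ->] := vC_Li1_half x.
rewrite ReImD ReImB (_ : (- 2^-1) ^+ n.-1 = ((- 2^-1) ^+ n.-1)%:C :> R[i]).
  2: by rewrite rmorphXn rmorphN fmorphV rmorph_nat.
rewrite ReIm_period addr0 -mulrA.
rewrite (_ : (_ + _) * _ = ((k%:~R / 2 + 2^-1) * 2^-1 ^+ n.-1)%:C :> R[i]).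
  by rewrite ReIm_period subr0.
by rewrite rmorphM rmorphXn rmorphD rmorphM fmorphV rmorph_int rmorph_nat.
Qed.

End Component.

(** * Limits at real points *)

Section Tends.
Variable R : realType.
Variable x : hatC R.
Implicit Types (D : hatC R -> Prop) (f g : hatC R -> R[i]) (l : R[i]) (e d : R).

(** Convergence at x in terms of u and v, along the points that satisfy D. *)
Definition tends D f l := forall e, 0 < e -> exists2 d, 0 < d & forall y, D y ->
  normc (uC y - uC x) < d -> normc (vC y - vC x) < d -> normc (f y - l) < e.

Lemma tends_cst D l : tends D (fun=> l) l.
Proof. by move=> e e0; exists 1 => // y _ _ _; rewrite subrr normc0. Qed.

Lemma tends_u D : tends D (@uC R) (uC x).
Proof. by move=> e e0; exists e. Qed.

Lemma tends_v D : tends D (@vC R) (vC x).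
Proof. by move=> e e0; exists e. Qed.

Lemma tends_comp2 D f g l m (h : hatC R -> R[i]) k :
  tends D f l -> tends D g m ->
  (forall e, 0 < e -> exists2 d, 0 < d & forall y, D y ->
    normc (f y - l) < d -> normc (g y - m) < d -> normc (h y - k) < e) ->
  tends D h k.
Proof.
move=> fl gm H e /H[d d0 {}H].
have [d1 d10 H1] := fl d d0; have [d2 d20 H2] := gm d d0.
exists (Num.min d1 d2); first by rewrite lt_min d10.
move=> y Dy; rewrite !lt_min => /andP[u1 u2] /andP[v1 v2].
by apply: H => //; [exact: H1|exact: H2].
Qed.

Lemma tendsD D f g l m : tends D f l -> tends D g m ->
  tends D (fun y => f y + g y) (l + m).
Proof.
move=> fl gm; apply: (tends_comp2 fl gm) => e e0.
exists (e / 2) => [|y _ Hf Hg]; first by rewrite divr_gt0.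
have -> : f y + g y - (l + m) = (f y - l) + (g y - m) by ring.
by rewrite (le_lt_trans (le_normcD _ _))//; lra.
Qed.

Lemma tendsM D f g l m : tends D f l -> tends D g m ->
  tends D (fun y => f y * g y) (l * m).
Proof.
move=> fl gm; apply: (tends_comp2 fl gm) => e e0.
pose K := normc l + normc m + 1.
have K0 : 0 < K by rewrite ltr_wpDl// addr_ge0// normc_ge0.
exists (Num.min 1 (e / K)) => [|y _]; first by rewrite lt_min ltr01 divr_gt0.
rewrite !lt_min => /andP[f1 fe] /andP[g1 ge].
have -> : f y * g y - l * m = (f y - l) * (g y - m) + l * (g y - m) + m * (f y - l).
  by ring.
rewrite (le_lt_trans (le_normcD _ _))//.
rewrite (le_lt_trans (lerD (le_normcD _ _) (lexx _)))// !normcM.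
have := normc_ge0 l; have := normc_ge0 m; have := normc_ge0 (f y - l).
have := normc_ge0 (g y - m).
move: fe ge; rewrite !ltr_pdivlMr// /K.
move: (normc (f y - l)) (normc (g y - m)) f1 g1 => s t s1 t1 hs ht t0 s0 m0 l0.
nra.
Qed.

Lemma tendsX D f l n : tends D f l -> tends D (fun y => f y ^+ n) (l ^+ n).
Proof.
move=> fl; elim: n => [|n IH]; first exact: tends_cst.
rewrite exprS (_ : (fun y => _) = fun y => f y * f y ^+ n); first exact: tendsM.
by apply/funext => y; rewrite exprS.
Qed.

Lemma tends_sum D n (f : nat -> hatC R -> R[i]) (l : nat -> R[i]) :
  (forall i, (i < n)%N -> tends D (f i) (l i)) ->
  tends D (fun y => \sum_(i < n) f i y) (\sum_(i < n) l i).
Proof.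
elim: n => [|n IH] H.
  rewrite big_ord0 (_ : (fun y => _) = fun=> 0); first exact: tends_cst.
  by apply/funext => y; rewrite big_ord0.
rewrite big_ord_recr/= (_ : (fun y => _) = fun y => (\sum_(i < n) f i y) + f n y).
  by apply: tendsD; [apply: IH => i /ltnW|]; exact: H.
by apply/funext => y; rewrite big_ord_recr.
Qed.

Lemma tendsN D f l : tends D f l -> tends D (fun y => - f y) (- l).
Proof.
move=> fl e e0; have [d d0 H] := fl e e0; exists d => // y Dy hu hv.
by rewrite -opprD normcN; exact: H.
Qed.

Lemma tendsB D f g l m : tends D f l -> tends D g m ->
  tends D (fun y => f y - g y) (l - m).
Proof. by move=> fl gm; apply: tendsD => //; exact: tendsN. Qed.

Lemma tends_ladder D (lam : hatC R -> nat -> R[i]) (lam0 : nat -> R[i]) n :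
  (forall k, tends D (fun y => lam y k.+1) (lam0 k.+1)) ->
  tends D (fun y => ladder (lam y) (uC y) (vC y) n)
    (ladder lam0 (uC x) (vC x) n).
Proof.
move=> H; apply: tendsB.
  apply: (@tends_sum D n (fun r y => (-1) ^+ r / r`!%:R * lam y (n - r)%N * uC y ^+ r)
    (fun r => (-1) ^+ r / r`!%:R * lam0 (n - r)%N * uC x ^+ r)) => r rn.
  apply: tendsM; last by apply: tendsX; exact: tends_u.
  apply: tendsM; first exact: tends_cst.
  by rewrite -(@prednK (n - r)) ?subn_gt0//; exact: H.
apply: tendsM; last exact: tends_v.
by apply: tendsM; [exact: tends_cst|apply: tendsX; exact: tends_u].
Qed.

Lemma tends_normal_form D (lam : hatC R -> nat -> R[i]) (lam0 : nat -> R[i]) n :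
  (forall k, tends D (fun y => lam y k.+1) (lam0 k.+1)) ->
  tends D (fun y => normal_form n (lam y) (uC y) (vC y))
    (normal_form n lam0 (uC x) (vC x)).
Proof.
move=> H; apply: tendsD; last exact: tends_cst.
apply: tendsB; first exact: tends_ladder.
apply: tendsM; last exact: tends_cst.
apply: tendsM; first exact: tends_cst.
apply: tendsD; last exact: tends_cst.
apply: tendsM; last exact: tends_cst.
by apply: tendsD; [exact: tends_v|exact: H].
Qed.

End Tends.

Section Limits.
Variable R : realType.
Implicit Types (x y : hatC R) (z w u h : R[i]) (e d : R).

Lemma continuous_at0 (g : R -> R) e : {for 0, continuous g} -> 0 < e ->
  exists2 d, 0 < d & forall t, `|t| < d -> `|g t - g 0| < e.
Proof.
move=> /cvgrPdist_lt cg e0; have [d /= d0 H] := cg e e0.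
by exists d => // t td; rewrite distrC; apply: H; rewrite /= sub0r normrN.
Qed.

Lemma expC_continuous0 e : 0 < e -> exists2 d, 0 < d &
  forall h, normc h < d -> normc (expC h - 1) < e.
Proof.
move=> e0; have e8 : 0 < Num.min 1 (e / 8) by rewrite lt_min ltr01 divr_gt0.
have [d1 d10 H1] := continuous_at0 (@continuous_expR R 0) e8.
have [d2 d20 H2] := continuous_at0 (@continuous_cos R 0) e8.
have [d3 d30 H3] := continuous_at0 (@continuous_sin R 0) e8.
exists (Num.min d1 (Num.min d2 d3)); first by rewrite !lt_min d10 d20 d30.
move=> h; rewrite !lt_min => /and3P[h1 h2 h3].
have {H1} := H1 _ (le_lt_trans (Re_le_normc h) h1); rewrite expR0.
have {H2} := H2 _ (le_lt_trans (Im_le_normc h) h2); rewrite cos0.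
have {H3} := H3 _ (le_lt_trans (Im_le_normc h) h3); rewrite sin0 subr0.
rewrite !lt_min => /andP[s1 s2] /andP[c1 c2] /andP[E1 E2].
rewrite (le_lt_trans (normc_le_ReIm _))// ReB ImB /= subr0.
set E := expR _ in E1 E2 *; set s := sin _ in s1 s2 *; set c := cos _ in c1 c2 *.
have -> : E * c - 1 = (E - 1) * (c - 1) + (E - 1) + (c - 1) by ring.
have -> : E * s = (E - 1) * s + s by ring.
have := ler_normD ((E - 1) * (c - 1) + (E - 1)) (c - 1).
have := ler_normD ((E - 1) * (c - 1)) (E - 1).
have := ler_normD ((E - 1) * s) s; rewrite !normrM.
have := normr_ge0 (E - 1); have := normr_ge0 (c - 1); have := normr_ge0 s.
move: E1 E2 s1 s2 c1 c2; move: `|E - 1| `|c - 1| `|s| => a b k *; nra.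
Qed.

Lemma expC_continuous u e : 0 < e -> exists2 d, 0 < d &
  forall w, normc (w - u) < d -> normc (expC w - expC u) < e.
Proof.
move=> e0; have n0 : 0 < normc (expC u) by rewrite normc_gt0 expC_neq0.
have [d d0 H] := expC_continuous0 (divr_gt0 e0 n0).
exists d => // w /H; rewrite ltr_pdivlMr// -normcM mulrBl mul1r -expCD.
by rewrite subrK.
Qed.

Lemma tends_rC x (D : hatC R -> Prop) : (forall y, D y -> neg1 y = neg1 x) ->
  tends x D (@rC R) (rC x).
Proof.
move=> DN e /(@expC_continuous (uC x))[d d0 H]; exists d => // y Dy hu _.
by rewrite /rC (DN y Dy) -mulrBr normc_sign H.
Qed.

Lemma Li_lower_continuous k z e : Im z <= 0 -> z != 1 -> 0 < e ->
  exists2 d, 0 < d & forall w, Im w <= 0 -> normc (w - z) < d ->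
    normc (Li k.+1 w - Li k.+1 z) < e.
Proof.
move=> Iz z1 e0; pose a := normc (1 - z).
have a0 : 0 < a by rewrite normc_gt0 subr_eq0 eq_sym.
have [K K0 HK] := @log_hoelder_Li R k (normc z + 1).
pose B := 2 * (Num.sqrt (a / 2))^-1.
have B0 : 0 < B by rewrite mulr_gt0// invr_gt0 sqrtr_gt0 divr_gt0.
have eKB : 0 < e / (K * B) by rewrite divr_gt0// mulr_gt0.
exists (Num.min 1 (Num.min (a / 2) ((e / (K * B)) ^+ 2))).
  by rewrite !lt_min ltr01 divr_gt0// exprn_gt0.
move=> w Iw; rewrite !lt_min => /and3P[w1 wa we].
have a2 : a / 2 <= normc (1 - w).
  have := normcB_ge (1 - z) (w - z); rewrite (_ : 1 - z - (w - z) = 1 - w); last by ring.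
  rewrite -/a; lra.
have wn1 : w != 1.
  rewrite eq_sym -subr_eq0 -normc_gt0 (lt_le_trans _ a2)// divr_gt0//.
have hw : normc w <= normc z + 1.
  by have := normcB_ge w z; lra.
rewrite (le_lt_trans (HK w z Iw Iz hw _ wn1 z1)) ?lerDl//.
apply: (@le_lt_trans _ _ (K * Num.sqrt (normc (w - z)) * B)).
  rewrite ler_wpM2l ?mulr_ge0 ?sqrtr_ge0 ?(ltW K0)//.
  rewrite /B mulr_natl mulr2n lerD// lef_pV2 ?posrE ?sqrtr_gt0 ?divr_gt0//.
  - by rewrite ler_wsqrtr.
  - by rewrite (lt_le_trans _ a2)// divr_gt0.
  - by rewrite ler_wsqrtr// -/a; lra.
have KB0 : 0 < K * B by rewrite mulr_gt0.
have : Num.sqrt (normc (w - z)) < e / (K * B).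
  by rewrite -[ltRHS]gtr0_norm// -sqrtr_sqr ltr_sqrt// exprn_gt0.
by rewrite ltr_pdivlMr// mulrCA mulrA.
Qed.

(** The value on the cut is the limit from below. *)
Lemma tends_Li_lower k x (D : hatC R -> Prop) :
  (forall y, D y -> neg1 y = neg1 x /\ Im (rC y) <= 0) -> Im (rC x) <= 0 ->
  tends x D (fun y => Li k.+1 (rC y)) (Li k.+1 (rC x)).
Proof.
move=> DN Ix e /(Li_lower_continuous k Ix (rC_neq1 x))[d d0 H].
have [d' d'0 H'] := @tends_rC x D (fun y Dy => (DN y Dy).1) d d0.
by exists d' => // y Dy hu hv; apply: H; [exact: (DN y Dy).2|exact: H'].
Qed.

Lemma tends_Li_upper k x (D : hatC R -> Prop) :
  (forall y, D y -> neg1 y = neg1 x /\ 0 < Im (rC y)) -> Im (rC x) = 0 ->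
  tends x D (fun y => Li k.+1 (rC y)) ((Li k.+1 (rC x))^*).
Proof.
move=> DN Ix e e0; have Ix0 : Im (rC x) <= 0 by rewrite Ix.
have [d d0 H] := Li_lower_continuous k Ix0 (rC_neq1 x) e0.
have [d' d'0 H'] := @tends_rC x D (fun y Dy => (DN y Dy).1) d d0.
exists d' => // y Dy hu hv; have [_ Iy] := DN y Dy.
have zE : rC x = (rC x)^* by rewrite (rC_real Ix) /= oppr0.
rewrite -normc_conjc rmorphB/= conjcK -Li_conjc ?gt_eqF//.
apply: H; first by rewrite Im_conjc oppr_le0 ltW.
by rewrite zE -rmorphB normc_conjc; exact: H'.
Qed.

(** From below the normal form converges to its value at x, from above to this
    value up to a multiple of the period. *)
Lemma hatL_mm_limit_normal_form n x : (1 < n)%N -> neg1 x -> neg2 x ->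
  Im (rC x) = 0 ->
  hatL_mm_limit n x (normal_form n (fun k => Li k (rC x)) (uC x) (vC x)).
Proof.
move=> n1 x1 x2 Ix e e0.
pose Dl y := [/\ neg1 y, neg2 y & Im (rC y) < 0].
pose Du y := [/\ neg1 y, neg2 y & 0 < Im (rC y)].
have [|dl dl0 Hl] := @tends_normal_form R x Dl (fun y k => Li k (rC y))
    (fun k => Li k (rC x)) n _ e e0.
  move=> k; apply: tends_Li_lower; rewrite ?Ix// => y [y1 y2 /ltW Iy].
  by rewrite y1 x1.
have [|du du0 Hu] := @tends_normal_form R x Du (fun y k => Li k (rC y))
    (fun k => (Li k (rC x))^*) n _ e e0.
  by move=> k; apply: tends_Li_upper => // y [y1 y2 Iy]; rewrite y1 x1.
have [k0 Hk0] := normal_form_conj n1 x1 Ix.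
exists (Num.min dl du); first by rewrite lt_min dl0.
move=> y y1 y2 Iy; rewrite !lt_min => /andP[ul uu] /andP[vl vu].
have [k ->] := hatL_mm_normal n1 y1 y2 Iy.
case: ltgtP Iy => // Iy _.
  exists (- k); rewrite rmorphN mulNr addrK; apply: Hl => //; split => //.
exists (- k - k0); have := Hu y (And3 y1 y2 Iy) uu vu.
rewrite Hk0 => H.
rewrite (_ : _ - _ = normal_form n (fun k => Li k (rC y)) (uC y) (vC y) -
  (normal_form n (fun k => Li k (rC x)) (uC x) (vC x) +
    k0%:~R * (kappa R n * period R n)))//.
by rewrite rmorphB rmorphN; ring.
Qed.

(** Rotate z = - exp u slightly into the lower half-plane and follow v by the
    logarithm of 1-z, which is continuous on the closed upper half-plane. *)
Lemma nonreal_nearby x d : neg1 x -> neg2 x -> Im (rC x) = 0 -> 0 < d ->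
  exists y, [/\ neg1 y, neg2 y, Im (rC y) != 0,
    normc (uC y - uC x) < d & normc (vC y - vC x) < d].
Proof.
move=> x1 x2 Ix d0; have Ix0 : Im (rC x) <= 0 by rewrite Ix.
have [d1 d10 H1] := Li_lower_continuous 0 Ix0 (rC_neq1 x) d0.
have [d2 d20 H2] := expC_continuous (uC x) d10.
pose t := Num.min 1 (Num.min (d / 2) (d2 / 2)).
have t0 : 0 < t by rewrite !lt_min ltr01 !divr_gt0.
have [t1 td td2] : [/\ t <= 1, t < d & t < d2].
  have : t <= d / 2 by rewrite !ge_min lexx orbT.
  have : t <= d2 / 2 by rewrite !ge_min lexx !orbT.
  by move=> h1 h2; split; [rewrite ge_min lexx|lra|lra].
have r0 : Re (rC x) != 0.
  by have := rC_neq0 x; rewrite {1}(rC_real Ix); apply: contra_neq => ->.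
(* the sign of the rotation that makes Im z negative *)
pose s : R := if 0 < Re (rC x) then - t else t.
have sE : `|s| = t by rewrite /s; case: ifP; rewrite ?normrN gtr0_norm.
pose u := uC x + s *i.
have uE : normc (u - uC x) = t.
  by rewrite /u addrC addKr /= expr0n add0r sqrtr_sqr.
pose z := - expC u.
have zx : normc (z - rC x) < d1.
  rewrite /z /rC x1 expr1 mulN1r -opprD normcN.
  by apply: H2; rewrite uE.
have Iz : Im z = Re (rC x) * sin s.
  rewrite /z expCD; have -> : expC (uC x) = - rC x by rewrite /rC x1 expr1 mulN1r opprK.
  by rewrite mulNr opprK ImM Ix mul0r addr0 /= expR0 mul1r.
have st0 : 0 < sin t.
  apply: sin_gt0_pi; rewrite t0 (le_lt_trans t1)//.
  by rewrite (lt_le_trans _ (pi_ge2 R))// ltr1n.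
have Iz0 : Im z < 0.
  rewrite Iz /s; have [h|h] := ltP 0 (Re (rC x)).
    by rewrite sinN mulrN oppr_lt0 mulr_gt0.
  by rewrite pmulr_llt0// lt_neqAle r0.
have z1 : 1 - z != 0.
  rewrite subr_eq0; apply: contraTneq Iz0 => <-.
  by rewrite /= ltxx.
have x1n : 1 - rC x != 0 by rewrite subr_eq0 eq_sym rC_neq1.
pose v := vC x + (LogC (1 - z) - LogC (1 - rC x)).
have E : (-1) ^+ true * expC u + (-1) ^+ true * expC v = 1.
  have Ev : expC v = - (1 - z).
    apply: (mulIf x1n); rewrite -{1}(expC_LogC x1n) -expCD /v addrA subrK.
    rewrite expCD (expC_LogC z1) mulrC.
    by rewrite [1 - rC x]oneB_rC x2 expr1 mulN1r mulrNN.
  rewrite Ev expr1 !mulN1r opprK /z; ring.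
exists (HatC E); split => //.
- have -> : rC (HatC E) = z by rewrite /rC [neg1 _]/= [uC _]/= expr1 mulN1r.
  by rewrite lt_eqF.
- by rewrite [uC (HatC E)]/= uE.
- rewrite [vC (HatC E)]/= /v addrC addKr normcBC.
  rewrite (_ : _ - _ = Li 1 z - Li 1 (rC x)); first exact: H1 (ltW Iz0) zx.
  by rewrite !Li1E; ring.
Qed.

Lemma ReIm_le_normc n z : `|ReIm n z| <= normc z.
Proof. by rewrite /ReIm; case: ifP => _; [exact: Re_le_normc|exact: Im_le_normc]. Qed.

(** Limits are determined up to the period only, but [ReIm] n kills the period.
    Nonreal points near x have to exist for two limits to be comparable. *)
Lemma hatL_mm_limit_ReIm n x w w' : (1 < n)%N -> neg1 x -> neg2 x ->
  Im (rC x) = 0 -> hatL_mm_limit n x w -> hatL_mm_limit n x w' ->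
  ReIm n w = ReIm n w'.
Proof.
move=> n1 x1 x2 Ix Hw Hw'; apply/eqP; rewrite -subr_eq0 -normr_le0.
apply/ler_addgt0Pr => e e0; rewrite add0r.
have e2 : 0 < e / 2 by rewrite divr_gt0.
have [d d0 H] := Hw _ e2; have [d' d'0 H'] := Hw' _ e2.
have [|y [y1 y2 Iy]] := @nonreal_nearby x (Num.min d d') x1 x2 Ix.
  by rewrite lt_min d0.
rewrite !lt_min => /andP[ud ud'] /andP[vd vd'].
have [k /(le_lt_trans (ReIm_le_normc n _))] := H y y1 y2 Iy ud vd.
have [k' /(le_lt_trans (ReIm_le_normc n _))] := H' y y1 y2 Iy ud' vd'.
have mmE j w0 : ReIm n (hatL_mm n y + j%:~R * (kappa R n * period R n) - w0) =
    ReIm n (hatL_mm n y) - ReIm n w0.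
  by rewrite ReImB [ReIm n (hatL_mm n y + _)]ReImD ReIm_kappa_period// addr0.
rewrite !mmE => h1 h2.
have -> : ReIm n w - ReIm n w' = (ReIm n (hatL_mm n y) - ReIm n w') -
  (ReIm n (hatL_mm n y) - ReIm n w) by ring.
by rewrite (le_trans (ler_normB _ _))//; lra.
Qed.

(** All ambiguities and corrections are rational multiples of (2 pi i)^n, which
    [ReIm] n kills. At real points of the component (-,-), [ReIm] n takes the
    same value at every limit, in particular at the normal form. *)
Lemma ReIm_hatL n x : (1 < n)%N ->
  ReIm n (hatL n x) =
  ReIm n (ladder (fun k => Li k (rC x)) (uC x) (vC x) n).
Proof.
move=> n1; have n0 := ltnW n1; rewrite /hatL.
case: ifPn => [/andP[x1 x2]|_]; last exact: ReIm_hatL_formula.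
case: eqP => [Ix|_]; last exact: ReIm_hatL_mm.
have H := hatL_mm_limit_normal_form n1 x1 x2 Ix.
rewrite -(ReIm_normal_form x n1); apply: (hatL_mm_limit_ReIm n1 x1 x2 Ix) => //.
by apply: (@xgetPex _ 0 [set w | hatL_mm_limit n x w]); eexists; exact: H.
Qed.

End Limits.

(** * The theorem *)

Theorem theorem2p10 (R : realType) (n : nat) (hn : (2 <= n)%N) :
  exists c d : nat -> nat -> rat, forall x : hatC R,
    ReIm n (hatL n x) - polylogR n (rC x) =
      \sum_(1 <= s < n.-1)
        (ReIm (n - s) (hatL (n - s) x) *
         \sum_(i < s.+1)
           ratr (c i (s - i)%N) * complex.Re (uC x) ^+ i * complex.Im (uC x) ^+ (s - i))
      + det_wedge (uC x) (vC x) *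
        \sum_(i < n.-1)
          ratr (d i (n - 2 - i)%N) * complex.Re (uC x) ^+ i * complex.Im (uC x) ^+ (n - 2 - i).
Proof.
exists (coefC n), (fun i _ => coefD n i) => x.
rewrite ReIm_hatL// /polylogR -Re_uC.
rewrite -/(todd_coef _) ReIm_ladder//; last exact: Re_ladder1.
congr (_ + _); apply: eq_big_nat => s /andP[_ sn].
by rewrite ReIm_hatL//; lia.
Qed.
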